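(* There exists a square root $G\in\mathcal{S}$ of Thompson's group $F$ such that $G$ does not admit a faithful action by piecewise linear homeomorphisms of a compact one-manifold.
   Context: Let $I=[0,1]$ and let $\mathrm{Homeo}^+(I)$ be the group of orientation-preserving homeomorphisms of $I$. For a homeomorphism $f$, $\operatorname{supp} f=\{x : f(x)\neq x\}$. Two nonempty open intervals $J_1,J_2$ form a two-chain if $J_1\cap J_2$ is a nonempty proper subinterval of $J_1$ and of $J_2$. Thompson's group is $F\cong\langle A,B\mid [A,(AB)^{-1}B(AB)],\ [A,(AB)^{-2}B(AB)^2]\rangle$. A square root of $F$ is a two-generated subgroup $\langle f,g\rangle<\mathrm{Homeo}^+(I)$ such that $\langle f^2,g^2\rangle\cong F$ and such that $\operatorname{supp} f$ and $\operatorname{supp} g$ are open intervals forming a two-chain. $\mathcal{S}$ denotes the set of isomorphism classes of square roots of $F$; $G\in\mathcal S$ means that $G$ is a square root of $F$. The compact one-manifolds considered are the interval $I$ and the circle $S^1$. *)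

(* Defs.v *)
From HB Require Import structures.
From mathcomp Require Import all_boot all_order all_algebra.
From mathcomp Require Import generic_quotient ring_quotient.
From mathcomp Require Import all_classical all_reals all_analysis.

Set Implicit Arguments.
Unset Strict Implicit.
Unset Printing Implicit Defensive.

Import Order.TTheory GRing.Theory Num.Theory.
Import numFieldNormedType.Exports.

Local Open Scope classical_set_scope.
Local Open Scope ring_scope.
Local Open Scope quotient_scope.

Definition generated (G : groupType) (S : set G) : set G :=
  smallest (fun A : set G => group_closed [in A]) S.

Definition isomorphic (F G : groupType) (A : set G) : Prop :=
  exists phi : F -> G,
    [/\ {morph phi : x y / (x * y)%g}, injective phi & range phi = A].

Arguments isomorphic F {G} A.

(* A faithful action of [A] through the transformations in [P]: an injective
   homomorphism from [A] into [H] with values in [P].  Only the values of [rho]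
   on [A] matter. *)
Definition faithful_action_by (G H : groupType) (A : set G) (P : set H) : Prop :=
  exists rho : G -> H,
    [/\ {in A &, {morph rho : x y / (x * y)%g}}, {in A &, injective rho}
      & rho @` A `<=` P].

Inductive gterm (X : Type) : Type :=
| GGen of X
| GOne
| GMul of gterm X & gterm X
| GInv of gterm X.

Arguments GGen {X}.
Arguments GOne {X}.

HB.instance Definition _ (X : Type) := gen_eqMixin (gterm X).
HB.instance Definition _ (X : Type) := gen_choiceMixin (gterm X).
HB.instance Definition _ (X : Type) := hasMul.Build (gterm X) (@GMul X).
HB.instance Definition _ (X : Type) := hasOne.Build (gterm X) GOne.
(* [gterm X] satisfies no group axiom: this instance only makes the notations
   [x^-1], [x ^+ n] and [[~ x, y]] available for writing relators. *)
HB.instance Definition _ (X : Type) := hasInv.Build (gterm X) (@GInv X).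

Section Presentation.
Context {X : Type} (rels : set (gterm X)).

Inductive pres_eq : gterm X -> gterm X -> Prop :=
| pres_refl x : pres_eq x x
| pres_sym x y : pres_eq x y -> pres_eq y x
| pres_trans x y z : pres_eq x y -> pres_eq y z -> pres_eq x z
| pres_mul x x' y y' :
    pres_eq x x' -> pres_eq y y' -> pres_eq (x * y)%g (x' * y')%g
| pres_inv x x' : pres_eq x x' -> pres_eq (x^-1)%g (x'^-1)%g
| pres_assoc x y z : pres_eq (x * (y * z))%g (x * y * z)%g
| pres_mul1g x : pres_eq (1 * x)%g x
| pres_mulg1 x : pres_eq (x * 1)%g x
| pres_mulVg x : pres_eq (x^-1 * x)%g 1%g
| pres_mulgV x : pres_eq (x * x^-1)%g 1%g
| pres_rel r : rels r -> pres_eq r 1%g.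

Definition pres_eqb : rel (gterm X) := fun x y => `[< pres_eq x y >].

Lemma pres_eqb_equiv : equiv_class_of pres_eqb.
Proof.
split=> [x|x y|y x z]; first by apply/asboolP; exact: pres_refl.
- by apply/asboolP/asboolP; exact: pres_sym.
- by move=> /asboolP xy /asboolP yz; apply/asboolP; exact: pres_trans yz.
Qed.

Canonical pres_equiv := EquivRelPack pres_eqb_equiv.
Canonical pres_encModRel := defaultEncModRel pres_eqb.

Definition presented := {eq_quot pres_eqb}.

HB.instance Definition _ := Choice.on presented.
HB.instance Definition _ : EqQuotient (gterm X) pres_eqb presented :=
  EqQuotient.on presented.

Definition presented_class (x : gterm X) : presented := \pi_presented x.

Lemma presented_classP x y :
  pres_eq x y <-> presented_class x = presented_class y.
Proof.
split=> [xy|/eqmodP/asboolP //].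
by apply/eqmodP/asboolP.
Qed.

Lemma pres_eq_repr x : pres_eq (repr (presented_class x)) x.
Proof. by apply/presented_classP; rewrite /presented_class reprK. Qed.

Definition presented_mul (x y : presented) : presented :=
  presented_class (repr x * repr y)%g.
Definition presented_inv (x : presented) : presented :=
  presented_class ((repr x)^-1)%g.
Definition presented_one : presented := presented_class 1%g.

Lemma presented_mulE x y :
  presented_mul (presented_class x) (presented_class y) =
  presented_class (x * y)%g.
Proof. by apply/presented_classP; apply: pres_mul; exact: pres_eq_repr. Qed.

Lemma presented_invE x :
  presented_inv (presented_class x) = presented_class (x^-1)%g.
Proof. by apply/presented_classP; apply: pres_inv; exact: pres_eq_repr. Qed.

Lemma presented_ind (P : presented -> Prop) :
  (forall x, P (presented_class x)) -> forall x, P x.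
Proof. by move=> Px x; rewrite -[x]reprK; exact: Px. Qed.

Lemma presented_mulA : associative presented_mul.
Proof.
elim/presented_ind=> x; elim/presented_ind=> y; elim/presented_ind=> z.
by rewrite !presented_mulE; apply/presented_classP; exact: pres_assoc.
Qed.

Lemma presented_mul1g : left_id presented_one presented_mul.
Proof.
elim/presented_ind=> x; rewrite presented_mulE.
by apply/presented_classP; exact: pres_mul1g.
Qed.

Lemma presented_mulg1 : right_id presented_one presented_mul.
Proof.
elim/presented_ind=> x; rewrite presented_mulE.
by apply/presented_classP; exact: pres_mulg1.
Qed.

Lemma presented_mulVg : left_inverse presented_one presented_inv presented_mul.
Proof.
elim/presented_ind=> x; rewrite presented_invE presented_mulE.
by apply/presented_classP; exact: pres_mulVg.
Qed.

Lemma presented_mulgV : right_inverse presented_one presented_inv presented_mul.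
Proof.
elim/presented_ind=> x; rewrite presented_invE presented_mulE.
by apply/presented_classP; exact: pres_mulgV.
Qed.

HB.instance Definition _ := isGroup.Build presented presented_mulA
  presented_mul1g presented_mulg1 presented_mulVg presented_mulgV.

End Presentation.

Arguments presented {X} rels.

Inductive thompson_gen := ThompsonA | ThompsonB.

Definition thompson_rels : set (gterm thompson_gen) :=
  let A := GGen ThompsonA in
  let B := GGen ThompsonB in
  [set [~ A, (A * B)^-1 * B * (A * B)]%g;
       [~ A, (A * B) ^- 2 * B * (A * B) ^+ 2]%g].

Definition thompsonF : groupType := presented thompson_rels.

Record homeo (T : topologicalType) := Homeo {
  homeo_fun :> T -> T;
  homeo_inv_fun : T -> T;
  homeoK : cancel homeo_fun homeo_inv_fun;
  homeoVK : cancel homeo_inv_fun homeo_fun;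
  homeo_continuous : continuous homeo_fun;
  homeo_inv_continuous : continuous homeo_inv_fun }.

Section HomeoGroup.
Context {T : topologicalType}.

HB.instance Definition _ := gen_eqMixin (homeo T).
HB.instance Definition _ := gen_choiceMixin (homeo T).

Lemma homeoP (f g : homeo T) : f =1 g -> f = g.
Proof.
case: f g => [f f' fK f'K cf cf'] [g g' gK g'K cg cg'] /= fg.
have efg : f = g by apply/funext.
have efg' : f' = g' by apply/funext => x; rewrite -{1}[x]g'K -fg fK.
subst g g'.
by rewrite (Prop_irrelevance fK gK) (Prop_irrelevance f'K g'K)
  (Prop_irrelevance cf cg) (Prop_irrelevance cf' cg').
Qed.

Definition homeo_one : homeo T :=
  @Homeo T idfun idfun (fun=> erefl) (fun=> erefl)
    (fun x => cvg_id) (fun x => cvg_id).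

Definition homeo_inv (f : homeo T) : homeo T :=
  Homeo (homeoVK f) (homeoK f) (@homeo_inv_continuous _ f) (@homeo_continuous _ f).

Lemma homeo_comp_continuous (f g : T -> T) :
  continuous f -> continuous g -> continuous (f \o g).
Proof. by move=> cf cg x; apply: continuous_comp; [exact: cg|exact: cf]. Qed.

(* [(f * g) x = f (g x)] *)
Definition homeo_mul (f g : homeo T) : homeo T :=
  Homeo (can_comp (homeoK f) (homeoK g)) (can_comp (homeoVK g) (homeoVK f))
    (homeo_comp_continuous (@homeo_continuous _ f) (@homeo_continuous _ g))
    (homeo_comp_continuous (@homeo_inv_continuous _ g)
       (@homeo_inv_continuous _ f)).

Lemma homeo_mulA : associative homeo_mul.
Proof. by move=> f g h; exact: homeoP. Qed.

Lemma homeo_mul1g : left_id homeo_one homeo_mul.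
Proof. by move=> f; exact: homeoP. Qed.

Lemma homeo_mulg1 : right_id homeo_one homeo_mul.
Proof. by move=> f; exact: homeoP. Qed.

Lemma homeo_mulVg : left_inverse homeo_one homeo_inv homeo_mul.
Proof. by move=> f; apply: homeoP => x /=; rewrite homeoK. Qed.

Lemma homeo_mulgV : right_inverse homeo_one homeo_inv homeo_mul.
Proof. by move=> f; apply: homeoP => x /=; rewrite homeoVK. Qed.

HB.instance Definition _ := isGroup.Build (homeo T)
  homeo_mulA homeo_mul1g homeo_mulg1 homeo_mulVg homeo_mulgV.

End HomeoGroup.

Section OneManifolds.
Context (R : realType).

Definition unit_interval : topologicalType := set_type `[(0 : R), 1]%classic.

(* The circle R/Z with the quotient topology; [x \is a Num.int] unfolds to
   [Num.int_num_subdef x]. *)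
Definition circle : topologicalType :=
  quotient_topology
    (Quotient.quot (GRing.ZmodClosed.clone R Num.int_num_subdef _)).

Definition to_circle (t : R) : circle := \pi_circle t.

Lemma to_circleP (x y : R) : to_circle x = to_circle y <-> x - y \is a Num.int.
Proof.
pose Z := GRing.ZmodClosed.clone R Num.int_num_subdef _.
rewrite -[x - y \is a _]/(x - y \in Z) (Quotient.idealrBE Z).
by split=> [h|/eqP h]; [apply/eqP|]; exact: h.
Qed.

Definition piecewise_linear (a b : R) (F : R -> R) : Prop :=
  exists2 s : seq R, itv_partition a b s &
    forall i, (i < size s)%N -> exists k c : R,
      {in `[nth b (a :: s) i, nth b (a :: s) i.+1], forall t, F t = k * t + c}.

Definition PL_unit_interval : set (homeo unit_interval) :=
  [set h | exists2 F : R -> R,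
    forall x, set_val (h x) = F (set_val x) & piecewise_linear 0 1 F].

(* A homeomorphism of R/Z is piecewise linear when it has a piecewise linear
   lift to R.  For a continuous lift [F], [F (t + 1) - F t] is an integer that does
   not depend on [t], so it is enough to look at the fundamental domain [0, 1]. *)
Definition PL_circle : set (homeo circle) :=
  [set h | exists F : R -> R,
    [/\ continuous F, forall t, h (to_circle t) = to_circle (F t)
      & piecewise_linear 0 1 F]].

Definition has_faithful_PL_action (G : groupType) (A : set G) : Prop :=
  faithful_action_by A PL_unit_interval \/
  faithful_action_by A PL_circle.

Definition homeo_plus : set (homeo unit_interval) :=
  [set f | forall x y, set_val x <= set_val y -> set_val (f x) <= set_val (f y)].

Definition supp (f : homeo unit_interval) : set R :=
  set_val @` [set x | f x != x].

Definition nonempty_open_interval (J : set R) : Prop :=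
  exists2 ab : R * R, ab.1 < ab.2 & J = `]ab.1, ab.2[%classic.

Definition two_chain (J1 J2 : set R) : Prop :=
  [/\ nonempty_open_interval J1, nonempty_open_interval J2,
      is_interval (J1 `&` J2) /\ J1 `&` J2 !=set0,
      J1 `&` J2 `<` J1 & J1 `&` J2 `<` J2].

Definition square_root_of_thompsonF (G : set (homeo unit_interval)) : Prop :=
  exists f g : homeo unit_interval,
    [/\ homeo_plus f, homeo_plus g, G = generated [set f; g],
        isomorphic thompsonF (generated [set (f ^+ 2)%g; (g ^+ 2)%g])
      & two_chain (supp f) (supp g)].

End OneManifolds.

(* Main.v *)
(* Let f and g be homeomorphisms of the line moving points to the left, with
   supports (-oo, c) and (d, +oo), d < c.  If f^2 g^2 moves c to the left of d,
   then f^2 and g^2 generate Thompson's group, whatever f and g are: the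
   relations say that f^2 commutes with conjugates of g^2 supported in (c, +oo);
   conversely every element is p q^-1 with p and q sorted words in the usual
   generators x_0, x_1, ..., and two distinct sorted words are separated by the
   left end points of the supports of the x_n.

   The square root f of f^2 can be prescribed on half of a fundamental domain.
   Take g with an explicit dyadic behaviour, f^2 a translation on a large region,
   and b in <f^2, g> supported in a small interval K.  Choosing f on K suitably,
   one finds z in <f, g> preserving K and such that b z^2 = z^2 b^2, so that <f, g>
   contains a copy of the Baumslag-Solitar group BS(1,2).

   This relation prevents piecewise linear actions.  Let A and B be piecewise
   linear lifts of z^-2 and b, normalized so that A B A^-1 = B^2.  Then B has a
   fixed point, since the translation number of B vanishes, and if B is not the
   identity it has a fixed point p with right slope k <> 1.  The right slopes of B
   at the fixed points A^n p are successive square roots of k, hence B has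
   infinitely many slopes. *)

From HB Require Import structures.
Require Import Defs.
From mathcomp Require Import all_boot all_order all_algebra.
From mathcomp Require Import all_classical all_reals all_analysis.
From mathcomp Require Import zify ring lra.

Set Implicit Arguments.
Unset Strict Implicit.
Unset Printing Implicit Defensive.

Import Order.TTheory GRing.Theory Num.Theory.
Import numFieldNormedType.Exports.

Local Open Scope classical_set_scope.
Local Open Scope ring_scope.

(** * Subgroups generated by a set, presented groups, words in Thompson's group *)

Local Open Scope group_scope.

Section Generated.
Context {G : groupType}.
Implicit Types (S : set G) (x y : G).

Lemma sub_generated S : S `<=` generated S.
Proof. exact: sub_smallest. Qed.

Lemma generated1 S : generated S 1.
Proof. by move=> A [[/set_mem A1 _] _]. Qed.

Lemma generated_div S x y : generated S x -> generated S y -> generated S (x / y).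
Proof.
move=> Sx Sy A [[A1 Adiv] SA]; apply/set_mem/Adiv; apply/mem_set.
- exact: Sx.
- exact: Sy.
Qed.

Lemma generatedV S x : generated S x -> generated S x^-1.
Proof. by move=> Sx; rewrite -[x^-1]mul1g; apply: generated_div => //; exact: generated1. Qed.

Lemma generatedM S x y : generated S x -> generated S y -> generated S (x * y).
Proof. by move=> Sx Sy; rewrite -[y]invgK; apply: generated_div => //; exact: generatedV. Qed.

Lemma generatedX S x n : generated S x -> generated S (x ^+ n).
Proof.
move=> Sx; elim: n => [|n IH]; first exact: generated1.
by rewrite expgS; exact: generatedM.
Qed.

Lemma generated_subset S (A : set G) :
  S `<=` A -> A 1 -> (forall x y, A x -> A y -> A (x / y)) -> generated S `<=` A.
Proof.
move=> SA A1 AB; apply: smallest_sub => //; split; first exact: mem_set.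
by move=> x y /set_mem Ax /set_mem Ay; apply/mem_set/AB.
Qed.

End Generated.

(** * Homomorphisms out of a presented group *)

Lemma presented_classM {X : Type} (rels : set (gterm X)) s t :
  presented_class rels (GMul s t) =
  (presented_class rels s * presented_class rels t :> presented rels).
Proof. by rewrite -presented_mulE. Qed.

Lemma presented_classV {X : Type} (rels : set (gterm X)) s :
  presented_class rels (GInv s) = ((presented_class rels s)^-1 :> presented rels).
Proof. by rewrite -presented_invE. Qed.

Section PresentedHom.
Context {X : Type} (rels : set (gterm X)) {H : groupType} (v : X -> H).

Fixpoint gterm_eval (t : gterm X) : H :=
  match t with
  | GGen x => v x
  | GOne => 1
  | GMul s t => gterm_eval s * gterm_eval t
  | GInv s => (gterm_eval s)^-1
  end.

Hypothesis v_rels : forall r, rels r -> gterm_eval r = 1.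

Lemma pres_eq_eval s t : pres_eq rels s t -> gterm_eval s = gterm_eval t.
Proof.
elim=> /= {s t} [x|x y _|x y z _ -> _|x x' y y' _ -> _ ->|x x' _ ->|x y z|x|x|x|x|r /v_rels] //.
- by rewrite mulgA.
- by rewrite mul1g.
- by rewrite mulg1.
- by rewrite mulVg.
- by rewrite mulgV.
Qed.

Definition presented_hom (x : presented rels) : H := gterm_eval (repr x).

Lemma presented_homE t : presented_hom (presented_class rels t) = gterm_eval t.
Proof. by apply: pres_eq_eval; exact: pres_eq_repr. Qed.

Lemma presented_homM : {morph presented_hom : x y / x * y}.
Proof.
elim/(@presented_ind X rels)=> x; elim/(@presented_ind X rels)=> y.
by rewrite -presented_classM !presented_homE.
Qed.

Lemma gterm_eval_generated t : generated (range v) (gterm_eval t).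
Proof.
elim: t => /= [y||s Ss t St|s Ss].
- by apply: sub_generated; exists y.
- exact: generated1.
- exact: generatedM.
- exact: generatedV.
Qed.

Lemma range_presented_hom : range presented_hom = generated (range v).
Proof.
rewrite eqEsubset; split; first by move=> _ [x _ <-]; exact: gterm_eval_generated.
apply: generated_subset.
- by move=> _ [x _ <-]; exists (presented_class rels (GGen x)); rewrite ?presented_homE.
- by exists (presented_class rels GOne); rewrite ?presented_homE.
- move=> _ _ [x _ <-] [y _ <-]; elim/(@presented_ind X rels): x => x.
  elim/(@presented_ind X rels): y => y.
  by exists (presented_class rels (GMul x (GInv y))); rewrite ?presented_homE.
Qed.

End PresentedHom.

(** In other words, the classes of the generators generate the presented group. *)
Lemma presented_classE {X : Type} (rels : set (gterm X)) t :
  presented_class rels t = gterm_eval (fun x => presented_class rels (GGen x)) t.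
Proof.
by elim: t => //= [s <- t <-|s <-]; rewrite (presented_classM, presented_classV).
Qed.

(** * Sorted words and fractions in a group satisfying Thompson's relations *)

Section ThompsonWords.
Context {H : groupType} (a b : H).
Hypothesis a_x2 : commute a (b ^ (a * b)).
Hypothesis a_x3 : commute a (b ^ ((a * b) ^+ 2)).

(** These are the usual generators of the infinite presentation of Thompson's group; [a] is
    recovered as [x 0 / x 1]. *)
Definition thompson_x (n : nat) : H :=
  if n is m.+1 then b ^ ((a * b) ^+ m) else a * b.
Local Notation x := thompson_x.

Lemma thompson_xS n : x n.+1 ^ x 0 = x n.+2.
Proof. by rewrite /= -conjgM -expgSr. Qed.

(** Conjugation by [x 0] raises every positive index by one, so a relation between positive indices
    can be shifted upwards. *)
Lemma thompson_x_shift i j k :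
  x j.+1 ^ x i.+1 = x j.+2 -> x (j + k).+1 ^ x (i + k).+1 = x (j + k).+2.
Proof.
move=> e; elim: k => [|k IH]; first by rewrite !addn0.
by rewrite !addnS -3!thompson_xS -conjJg IH.
Qed.

(** The two given relations yield the cases [n = 2] and [n = 3]. For larger [n], write [x n] as the
    conjugate of [x n.-1] by [x n.-2] and apply the induction hypothesis to both. *)
Lemma thompson_x1 n : (1 < n)%N -> x n ^ x 1 = x n.+1.
Proof.
(* On an element commuting with [a], conjugation by [x 1 = b] agrees with conjugation by
   [x 0 = a * b]. *)
have e j : commute a (x j.+1) -> x j.+1 ^ x 1 = x j.+2.
  move=> aj; rewrite -thompson_xS /= expg0 conjg1 conjgM; congr (_ ^ b).
  by rewrite [RHS]/conjg -aj mulKg.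
have e2 : x 2 ^ x 1 = x 3 by apply: e; rewrite /= expg1.
elim/ltn_ind: n => -[|[|[|[|n]]]] // IH _; first exact: e.
have s k : x k.+2 ^ x k.+1 = x k.+3.
  by have := @thompson_x_shift 0 1 k e2; rewrite add0n add1n.
by rewrite -(s n.+1) conjJg !IH //; apply: s.
Qed.

Lemma thompson_x_rel i j : (i < j)%N -> x j * x i = x i * x j.+1.
Proof.
suff: (i < j)%N -> x j ^ x i = x j.+1.
  by move=> e /e <-; rewrite /conjg !mulgA mulgV mul1g.
case: i => [|i]; first by case: j => // j _; rewrite thompson_xS.
case: j => // j; rewrite ltnS => ij.
have := @thompson_x_shift 0 (j - i) i (thompson_x1 _).
by rewrite subnK ?add0n; [apply; lia|lia].
Qed.

Lemma thompson_x1E : x 1 = b.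
Proof. by rewrite /= expg0 conjg1. Qed.

Definition thompson_word (s : seq nat) : H := \prod_(i <- s) x i.
Local Notation word := thompson_word.

Lemma thompson_word_cons i s : word (i :: s) = x i * word s.
Proof. by rewrite /word big_cons. Qed.

Lemma thompson_word_cat s t : word (s ++ t) = word s * word t.
Proof. by rewrite /word big_cat. Qed.

(** Moving [x j] to the right past a smaller letter raises its index, whence [j.+1] in the recursive
    call. *)
Fixpoint thompson_insert (j : nat) (s : seq nat) : seq nat :=
  if s is i :: s' then
    if (j <= i)%N then j :: s else i :: thompson_insert j.+1 s'
  else [:: j].

Definition thompson_sort (s : seq nat) : seq nat := foldr thompson_insert [::] s.

Lemma word_insert j s : word (thompson_insert j s) = x j * word s.
Proof.
elim: s j => [|i s IH] j; first by rewrite !thompson_word_cons.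
rewrite /=; case: leqP => ij; rewrite !thompson_word_cons ?IH //.
by rewrite mulgA -(thompson_x_rel ij) mulgA.
Qed.

Lemma word_sort s : word (thompson_sort s) = word s.
Proof. by elim: s => //= i s IH; rewrite word_insert IH thompson_word_cons. Qed.

Lemma path_insert k j s : (k <= j)%N -> path leq k s -> path leq k (thompson_insert j s).
Proof.
elim: s k j => [|i s IH] k j kj /=; first by rewrite kj.
move=> /andP[ki si]; case: leqP => ij /=; first by rewrite kj ij si.
by rewrite ki IH // leqW // ltnW.
Qed.

Lemma thompson_sort_sorted s : sorted leq (thompson_sort s).
Proof.
suff: path leq 0 (thompson_sort s) by exact: path_sorted.
by elim: s => //= i s IH; exact: path_insert.
Qed.

(* The right Ore condition: a negative letter moves to the right through a
   positive word, possibly being cancelled on the way. *)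
Lemma word_invl i s : exists t e,
  (x i)^-1 * word s = word t * (word e)^-1.
Proof.
elim: s i => [|j s IH] i.
  by exists [::], [:: i]; rewrite thompson_word_cons /word !big_nil mulg1 mul1g mulg1.
rewrite thompson_word_cons.
have [ij|ji|->] := ltngtP i j.
- have [t [e te]] := IH i; exists (j.+1 :: t), e.
  rewrite thompson_word_cons -mulgA -te; apply: (mulgI (x i)).
  by rewrite mulVKg [RHS]mulgA -(thompson_x_rel ij) -mulgA mulVKg.
- have [t [e te]] := IH i.+1; exists (j :: t), e.
  rewrite thompson_word_cons -mulgA -te; apply: (mulgI (x i)).
  by rewrite mulVKg [RHS]mulgA (thompson_x_rel ji) -mulgA mulVKg.
- by exists s, [::]; rewrite /word big_nil invg1 mulg1 mulKg.
Qed.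

Lemma word_ore q p : exists r s, (word q)^-1 * word p = word r * (word s)^-1.
Proof.
elim: q p => [|i q IH] p.
  by exists p, [::]; rewrite /word !big_nil invg1 mul1g mulg1.
have [t [e te]] := word_invl i p; have [r [s rs]] := IH t.
exists r, (e ++ s).
by rewrite thompson_word_cons invgM -mulgA te mulgA rs -mulgA -invgM thompson_word_cat.
Qed.

(** The Ore condition turns a quotient of two fractions into a fraction, by rewriting the product of
    the two inner words. *)
Lemma thompson_fraction z : generated [set a; b] z ->
  exists p q, z = word p * (word q)^-1.
Proof.
apply: (@generated_subset H _ [set z | exists p q, z = word p * (word q)^-1]).
- move=> _ [->|->].
    exists [:: 0%N], [:: 1%N].
    by rewrite !thompson_word_cons thompson_x1E /word !big_nil !mulg1 mulgK.
  exists [:: 1%N], [::].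
  by rewrite thompson_word_cons thompson_x1E /word big_nil invg1 !mulg1.
- by exists [::], [::]; rewrite /word big_nil invg1 mulg1.
- move=> _ _ [p [q ->]] [p' [q' ->]].
  have [r [s rs]] := word_ore q q'.
  exists (p ++ r), (p' ++ s).
  by rewrite !thompson_word_cat !invgM invgK -!mulgA; congr (_ * _); rewrite mulgA rs -mulgA.
Qed.

End ThompsonWords.

(** * Two-chains of increasing bijections of the line *)

Section GroupMorphism.
Context {G H : groupType} (phi : G -> H).
Hypothesis phiM : {morph phi : x y / x * y}.

Lemma morph_one : phi 1 = 1.
Proof. by apply: (mulgI (phi 1)); rewrite -phiM !mulg1. Qed.

Lemma morph_inv x : phi x^-1 = (phi x)^-1.
Proof. by apply: (mulgI (phi x)); rewrite -phiM !mulgV morph_one. Qed.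

Lemma morph_exp x n : phi (x ^+ n) = phi x ^+ n.
Proof. by elim: n => [|n IH]; rewrite ?expg0 ?morph_one // !expgS phiM IH. Qed.

Lemma morph_conj x y : phi (x ^ y) = phi x ^ phi y.
Proof. by rewrite /conjg !phiM morph_inv. Qed.

Lemma morph_generated (S : set G) x :
  generated S x -> generated (phi @` S) (phi x).
Proof.
apply: (@generated_subset G S [set x | generated (phi @` S) (phi x)]).
- by move=> y Sy; apply: sub_generated; exists y.
- by rewrite /= morph_one; exact: generated1.
- by move=> y z; rewrite /= phiM morph_inv; exact: generated_div.
Qed.

Lemma image_generated (S : set G) :
  phi @` generated S = generated (phi @` S).
Proof.
rewrite eqEsubset; split; first by move=> _ [x Sx <-]; exact: morph_generated.
apply: generated_subset.
- by move=> _ [x Sx <-]; exists x => //; exact: sub_generated.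
- by exists 1; [exact: generated1|exact: morph_one].
- move=> _ _ [x Sx <-] [y Sy <-]; exists (x / y); first exact: generated_div.
  by rewrite phiM morph_inv.
Qed.

Lemma morph_thompson_word a b s :
  phi (thompson_word a b s) = thompson_word (phi a) (phi b) s.
Proof.
elim: s => [|i s IH]; first by rewrite /thompson_word !big_nil morph_one.
rewrite !thompson_word_cons phiM IH; congr (_ * _).
by case: i => [|i]; rewrite /= ?morph_conj ?morph_exp phiM.
Qed.

Lemma injective_morph : (forall x, phi x = 1 -> x = 1) -> injective phi.
Proof.
move=> phi1 x y xy; apply: divg1_eq; apply: phi1.
by rewrite phiM morph_inv xy mulgV.
Qed.

End GroupMorphism.

Lemma isomorphic_image (F G H : groupType) (A : set G) (phi : G -> H) :
  {morph phi : x y / x * y} -> injective phi ->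
  isomorphic F A -> isomorphic F (phi @` A).
Proof.
move=> phiM phi_inj [psi [psiM psi_inj <-]]; exists (phi \o psi); split.
- by move=> x y /=; rewrite psiM phiM.
- exact: inj_comp.
- by rewrite image_comp.
Qed.

(** * The group of increasing bijections of the line *)

Section IncreasingBijections.
Context {R : realType}.

(** Continuity is automatic for an increasing bijection of the line; it is recovered in
    [ibij_continuous]. *)
Record ibij := IBij {
  ibij_fun :> R -> R;
  ibij_inv_fun : R -> R;
  ibijK : cancel ibij_fun ibij_inv_fun;
  ibijVK : cancel ibij_inv_fun ibij_fun;
  ibij_le : {mono ibij_fun : x y / (x <= y)%R} }.

HB.instance Definition _ := gen_eqMixin ibij.
HB.instance Definition _ := gen_choiceMixin ibij.

Lemma ibijP (f g : ibij) : f =1 g -> f = g.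
Proof.
case: f g => [f f' fK f'K lef] [g g' gK g'K leg] /= fg.
have efg : f = g by apply/funext.
have efg' : f' = g' by apply/funext => x; rewrite -{1}[x]g'K -fg fK.
subst g g'.
by rewrite (Prop_irrelevance fK gK) (Prop_irrelevance f'K g'K)
  (Prop_irrelevance lef leg).
Qed.

Lemma ibij_inv_le (f : ibij) : {mono ibij_inv_fun f : x y / (x <= y)%R}.
Proof. by move=> x y; rewrite -(ibij_le f) !ibijVK. Qed.

Definition ibij_one : ibij :=
  @IBij idfun idfun (fun=> erefl) (fun=> erefl) (fun _ _ => erefl).

Definition ibij_inv (f : ibij) : ibij :=
  IBij (ibijVK f) (ibijK f) (ibij_inv_le f).

Lemma ibij_comp_le (f g : ibij) : {mono f \o g : x y / (x <= y)%R}.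
Proof. by move=> x y /=; rewrite !ibij_le. Qed.

Definition ibij_mul (f g : ibij) : ibij :=
  IBij (can_comp (ibijK f) (ibijK g)) (can_comp (ibijVK g) (ibijVK f))
    (ibij_comp_le f g).

Lemma ibij_mulA : associative ibij_mul.
Proof. by move=> f g h; exact: ibijP. Qed.

Lemma ibij_mul1g : left_id ibij_one ibij_mul.
Proof. by move=> f; exact: ibijP. Qed.

Lemma ibij_mulg1 : right_id ibij_one ibij_mul.
Proof. by move=> f; exact: ibijP. Qed.

Lemma ibij_mulVg : left_inverse ibij_one ibij_inv ibij_mul.
Proof. by move=> f; apply: ibijP => x /=; rewrite ibijK. Qed.

Lemma ibij_mulgV : right_inverse ibij_one ibij_inv ibij_mul.
Proof. by move=> f; apply: ibijP => x /=; rewrite ibijVK. Qed.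

HB.instance Definition _ := isGroup.Build ibij
  ibij_mulA ibij_mul1g ibij_mulg1 ibij_mulVg ibij_mulgV.

Lemma ibijM (f g : ibij) x : (f * g) x = f (g x). Proof. by []. Qed.

Lemma ibij_conj (f g : ibij) x : (f ^ g) x = g^-1 (f (g x)). Proof. by []. Qed.

Lemma ibij1 x : (1 : ibij) x = x. Proof. by []. Qed.

Lemma ibijVKE (f : ibij) x : f (f^-1 x) = x. Proof. exact: ibijVK. Qed.

Lemma ibijKE (f : ibij) x : f^-1 (f x) = x. Proof. exact: ibijK. Qed.

Lemma ibijXS (f : ibij) n x : (f ^+ n.+1) x = f ((f ^+ n) x).
Proof. by rewrite expgS. Qed.

Lemma ibijXSr (f : ibij) n x : (f ^+ n.+1) x = (f ^+ n) (f x).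
Proof. by rewrite expgSr. Qed.

Lemma ibij_lt (f : ibij) : {mono f : x y / (x < y)%R}.
Proof. exact: leW_mono (ibij_le f). Qed.

Lemma ibij_inj (f : ibij) : injective f.
Proof. exact: can_inj (ibijK f). Qed.

Lemma ibij_lt_inv (f : ibij) x y : (f x < y)%R = (x < f^-1%g y)%R.
Proof. by rewrite -(ibij_lt f^-1) ibijKE. Qed.

Lemma ibij_le_inv (f : ibij) x y : (f x <= y)%R = (x <= f^-1%g y)%R.
Proof. by rewrite -(ibij_le f^-1) ibijKE. Qed.

Lemma ibij_fixV (f : ibij) x : f x = x -> f^-1 x = x.
Proof. by move=> fx; rewrite -{1}fx ibijKE. Qed.

Lemma ibij_segment (f : ibij) a b s : f a = a -> f b = b ->
  (a <= f s <= b)%R = (a <= s <= b)%R.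
Proof. by move=> fa fb; rewrite -{1}fa -{1}fb !ibij_le. Qed.

End IncreasingBijections.

Arguments ibij : clear implicits.

(** * Thompson's group from two overlapping supports *)

Section Chain.
Context {R : realType} (A B : ibij R) (c d : R).
Hypothesis A_lt : forall y, (y < c)%R -> (A y < y)%R.
Hypothesis A_fix : forall y, (c <= y)%R -> A y = y.
Hypothesis B_fix : forall y, (y <= d)%R -> B y = y.
Hypothesis B_lt : forall y, (d < y)%R -> (B y < y)%R.
Hypothesis d_lt_c : (d < c)%R.
Hypothesis ABc : (A (B c) <= d)%R.

Local Notation x := (thompson_x A B).

(** The left end point of the support of [x n.+1], which is the conjugate of [B] by
    [(A * B) ^+ n]. *)
Definition chain_end n : R := ((A * B)^-1 ^+ n)%g d.
Local Notation e := chain_end.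

Lemma chain_A_le y : (A y <= y)%R.
Proof. by case: (ltP y c) => [/A_lt/ltW|/A_fix->]. Qed.

Lemma chain_B_le y : (B y <= y)%R.
Proof. by case: (leP y d) => [/B_fix->|/B_lt/ltW]. Qed.

Lemma chain_AB_lt y : ((A * B)%g y < y)%R.
Proof.
rewrite ibijM; case: (ltP y c) => yc.
  by rewrite (lt_le_trans (A_lt _)) ?chain_B_le // (le_lt_trans (chain_B_le y)).
by rewrite (le_lt_trans (chain_A_le _)) // B_lt // (lt_le_trans d_lt_c).
Qed.

Lemma chain_end_lt n : (e n < e n.+1)%R.
Proof. by rewrite /e ibijXS -ibij_lt_inv chain_AB_lt. Qed.

Lemma chain_end_le : {homo e : m n / (m <= n)%N >-> (m <= n)%R}.
Proof. by apply: homo_leq => [//|n m p|n]; [exact: le_trans|rewrite ltW // chain_end_lt]. Qed.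

Lemma thompson_xSE n y :
  x n.+1 y = ((A * B)^-1 ^+ n) (B (((A * B) ^+ n) y)).
Proof. by rewrite /thompson_x /conjg -expVgn. Qed.

Lemma expVKE (f : ibij R) n y : (f^-1 ^+ n) ((f ^+ n) y) = y.
Proof. by rewrite -ibijM -[RHS]/((1 : ibij R) y) expVgn mulVg. Qed.

Lemma expKVE (f : ibij R) n y : (f ^+ n) ((f^-1 ^+ n) y) = y.
Proof. by rewrite -ibijM -[RHS]/((1 : ibij R) y) expVgn mulgV. Qed.

Lemma thompson_x_fix n y : (y <= e n)%R -> x n.+1 y = y.
Proof.
move=> ye; rewrite thompson_xSE B_fix ?expVKE //.
by rewrite -(ibij_le ((A * B)^-1 ^+ n)) expVKE.
Qed.

Lemma thompson_x_lt n y : (e n < y)%R -> (x n.+1 y < y)%R.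
Proof.
move=> ey; rewrite thompson_xSE -(ibij_lt ((A * B) ^+ n)) expKVE B_lt //.
by rewrite -(ibij_lt ((A * B)^-1 ^+ n)) expVKE.
Qed.

(** The hypothesis [ABc] means [c <= e 1], so [A] and [x n.+2] have disjoint supports. *)
Lemma chain_commute n : commute A (x n.+2).
Proof.
have ce : (c <= e n.+1)%R.
  apply: le_trans (chain_end_le (ltn0Sn n)).
  by rewrite /e expg1 -ibij_le_inv ibijM.
apply: ibijP => y; rewrite [LHS]ibijM [RHS]ibijM; case: (ltP y c) => yc.
  by rewrite !thompson_x_fix // (le_trans _ ce) // ltW // (lt_trans (A_lt yc)).
rewrite (A_fix yc) A_fix // -[leLHS](thompson_x_fix ce).
by rewrite ibij_le.
Qed.

(** This is the support of [x n]; for [n = 0] it is the whole line, since [A * B] moves every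
    point. *)
Definition chain_region n (y : R) : bool := if n is m.+1 then (e m < y)%R else true.

Lemma chain_region_lt n y : chain_region n y -> (x n y < y)%R.
Proof. by case: n => [_|n]; [exact: chain_AB_lt|exact: thompson_x_lt]. Qed.

Lemma chain_region_stable n m y : (n <= m)%N -> chain_region n y ->
  chain_region n (x m y) && (x m y <= y)%R.
Proof.
move=> nm ny.
case: n nm ny => [|n] nm /= ny; last first.
  have e_fix : x m (e n) = e n.
    by case: m nm => // m nm; rewrite thompson_x_fix // chain_end_le.
  rewrite -{1}e_fix ibij_lt ny /=.
  case: m nm {e_fix} => // m _; case: (leP y (e m)) => [/thompson_x_fix->//|/thompson_x_lt/ltW//].
case: m nm => [|m] _; first by rewrite ltW // chain_AB_lt.
by case: (leP y (e m)) => [/thompson_x_fix->//|/thompson_x_lt/ltW].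
Qed.

Local Notation word := (thompson_word A B).

Lemma chain_word_region n s y : all (leq n) s -> chain_region n y ->
  chain_region n (word s y) && (word s y <= y)%R.
Proof.
elim: s => [|m s IH] /=; first by move=> _ ny; rewrite /word big_nil ny /=.
move=> /andP[nm ns] ny; have /andP[nw wy] := IH ns ny.
rewrite thompson_word_cons ibijM; have /andP[-> /le_trans->//] := chain_region_stable nm nw.
Qed.

Lemma chain_word_lt n s : all (leq n) s -> (word (n :: s) (e n) < e n)%R.
Proof.
move=> ns; have en : chain_region n (e n) by case: (n) => //= k; exact: chain_end_lt.
have /andP[nw we] := chain_word_region ns en.
by rewrite thompson_word_cons ibijM (lt_le_trans (chain_region_lt nw)).
Qed.

Lemma chain_word_fix n s : all (leq n.+1) s -> word s (e n) = e n.
Proof.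
elim: s => [|m s IH] /=; first by rewrite /word big_nil.
move=> /andP[nm ns]; rewrite thompson_word_cons ibijM IH //.
by case: m nm => // m nm; rewrite thompson_x_fix // chain_end_le.
Qed.

(** Evaluation at [e i] detects the first letter: a sorted word starting with [i] moves [e i], while
    a word with all letters above [i] fixes it. Equal first letters cancel. *)
Lemma chain_sorted_inj s t : sorted leq s -> sorted leq t -> word s = word t -> s = t.
Proof.
have lo i u : path leq i u -> all (leq i) u by exact/order_path_min/leq_trans.
have hi i j u : (i < j)%N -> path leq j u -> all (leq i.+1) (j :: u).
  by move=> ij /lo ju; rewrite /= ij (sub_all _ ju) // => k; exact: leq_trans.
have neq i u v : all (leq i) u -> all (leq i.+1) v -> word (i :: u) <> word v.
  by move=> iu iv /(congr1 (fun f : ibij R => f (e i))) E; have := chain_word_lt iu;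
    rewrite E chain_word_fix // ltxx.
elim: s t => [|i s IH] [|j t] //= ss st E.
- by case: (@neq j t [::]) => //; exact: lo.
- by case: (@neq i s [::]) => //; exact: lo.
have [ij|ji|ij] := ltngtP i j.
- by case: (@neq i s (j :: t)) => //; [exact: lo|exact: hi].
- by case: (@neq j t (i :: s)) => //; [exact: lo|exact: hi].
- move: st E; rewrite -{}ij !thompson_word_cons => st /mulgI E.
  by rewrite (IH t) ?(path_sorted ss) ?(path_sorted st).
Qed.

(** For injectivity, write an element of the presented group as a fraction of two sorted words. If
    its image is trivial, the two words have the same image, hence coincide. *)
Lemma chain_isomorphic : isomorphic thompsonF (generated [set A; B]).
Proof.
pose tA := GGen ThompsonA; pose tB := GGen ThompsonB.
pose v (H : groupType) (u w : H) g := match g with ThompsonA => u | ThompsonB => w end.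
have relE (H : groupType) (u w : H) : [/\
    gterm_eval (v H u w) [~ tA, (tA * tB)^-1 * tB * (tA * tB)] = [~ u, w ^ ((u * w) ^+ 1)] &
    gterm_eval (v H u w) [~ tA, (tA * tB) ^- 2 * tB * (tA * tB) ^+ 2] =
      [~ u, w ^ ((u * w) ^+ 2)]].
  have e y : y^-1 * w * y = w ^ y by rewrite /conjg mulgA.
  by split; rewrite /= e.
have vrels r : thompson_rels r -> gterm_eval (v _ A B) r = 1.
  have [r1 r2] := relE _ A B.
  by case=> ->; rewrite ?r1 ?r2; apply/eqP/commgP; exact: chain_commute.
pose a := presented_class thompson_rels (GGen ThompsonA).
pose b := presented_class thompson_rels (GGen ThompsonB).
have vab : (fun g => presented_class thompson_rels (GGen g)) = v thompsonF a b.
  by apply/funext; case.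
have [/esym r1 /esym r2] := relE thompsonF a b; rewrite -vab -!presented_classE in r1 r2.
have a2 : commute a (b ^ (a * b)).
  apply/commgP; rewrite -[X in b ^ X]expg1 r1.
  by apply/eqP/presented_classP; apply: pres_rel; left.
have a3 : commute a (b ^ ((a * b) ^+ 2)).
  by apply/commgP; rewrite r2; apply/eqP/presented_classP; apply: pres_rel; right.
have rv (H : groupType) (u w : H) : range (v H u w) = [set u; w].
  rewrite eqEsubset; split; first by move=> _ [[] _ <-]; [left|right].
  by move=> _ [->|->]; [exists ThompsonA|exists ThompsonB].
pose phi := @presented_hom _ thompson_rels _ (v _ A B).
have phiM : {morph phi : x y / x * y} by exact: presented_homM.
have phia : phi a = A by rewrite /phi presented_homE.
have phib : phi b = B by rewrite /phi presented_homE.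
exists phi; split => //; last by rewrite range_presented_hom // rv.
apply: injective_morph => // w phiw.
have : generated [set a; b] w.
  elim/(@presented_ind _ thompson_rels): w {phiw} => t.
  by rewrite presented_classE vab -(rv thompsonF); exact: gterm_eval_generated.
move=> /(thompson_fraction a2 a3)[p [q]].
rewrite -(word_sort a2 a3 p) -(word_sort a2 a3 q) => wE.
move: phiw; rewrite wE phiM (morph_inv phiM) !(morph_thompson_word phiM) phia phib.
move=> /divg1_eq /(chain_sorted_inj (thompson_sort_sorted p) (thompson_sort_sorted q)) ->.
by rewrite mulgV.
Qed.

End Chain.

Local Close Scope group_scope.

(** * Conjugating, periodizing and linearizing increasing bijections *)

Section Transport.
Context {R : realType} (k : R -> R).
Hypothesis k_le : {mono k : x y / x <= y}.
Hypothesis k_itv : is_interval (range k).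
Implicit Types p q : ibij R.

(** The conjugate of [p] by [k] on the range of [k], extended by the identity; choosing preimages
    avoids an explicit inverse of [k]. *)
Definition transport_fun (p : R -> R) (y : R) : R :=
  if pselect (exists t, k t = y) is left e then k (p (projT1 (cid e))) else y.

Lemma transport_fun_in p t : transport_fun p (k t) = k (p t).
Proof.
rewrite /transport_fun; case: pselect => [e|[]]; last by exists t.
by case: (cid e) => s /= /(inc_inj k_le) ->.
Qed.

Lemma transport_fun_out p y : ~ range k y -> transport_fun p y = y.
Proof.
by rewrite /transport_fun; case: pselect => // -[t kt] []; exists t.
Qed.

(** As the range of [k] is an interval, a point outside it lies on the same side of [k s] and of
    [k (p s)]. *)
Lemma transport_fun_lt p : {homo transport_fun p : x y / x < y}.
Proof.
have k_lt := leW_mono k_le.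
move=> x y xy.
case: (pselect (range k x)) => [[s _ sx]|xo]; case: (pselect (range k y)) => [[t _ ty]|yo].
- by rewrite -sx -ty !transport_fun_in k_lt ibij_lt -k_lt sx ty.
- rewrite (transport_fun_out p yo) -sx transport_fun_in ltNge; apply/negP => yk.
  by apply: yo; apply: (@k_itv (k s) (k (p s))); [exists s|exists (p s)|rewrite yk sx ltW].
- rewrite (transport_fun_out p xo) -ty transport_fun_in ltNge; apply/negP => kx.
  by apply: xo; apply: (@k_itv (k (p t)) (k t)); [exists (p t)|exists t|rewrite kx ty ltW].
- by rewrite !transport_fun_out.
Qed.

Lemma transport_fun_le p : {mono transport_fun p : x y / x <= y}.
Proof. exact/le_mono/transport_fun_lt. Qed.

Lemma transport_funK p : cancel (transport_fun p) (transport_fun p^-1%g).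
Proof.
move=> y; case: (pselect (range k y)) => [[t _ <-]|yo].
  by rewrite !transport_fun_in ibijKE.
by rewrite !transport_fun_out.
Qed.

Definition transport p : ibij R :=
  IBij (transport_funK p) (transport_funK p^-1%g) (transport_fun_le p).

Lemma transport_in p t : transport p (k t) = k (p t).
Proof. exact: transport_fun_in. Qed.

Lemma transport_out p y : ~ range k y -> transport p y = y.
Proof. exact: transport_fun_out. Qed.

Lemma transportM : {morph transport : p q / (p * q)%g}.
Proof.
move=> p q; apply: ibijP => y; rewrite ibijM.
case: (pselect (range k y)) => [[t _ <-]|yo]; first by rewrite !transport_in.
by rewrite !transport_out.
Qed.

End Transport.

Section AffineMaps.
Context {R : realType}.

Definition translate (a : R) : ibij R := IBij (addrK a) (addrNK a) (fun x y => lerD2r a x y).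

Lemma translateE a x : translate a x = x + a. Proof. by []. Qed.

Lemma translateM a b : (translate a * translate b)%g = translate (b + a).
Proof. by apply: ibijP => x; rewrite ibijM !translateE addrA. Qed.

Definition scale_by (a : {posnum R}) : ibij R :=
  @IBij R (fun x => x * a%:num) (fun x => x / a%:num)
    (mulfK (lt0r_neq0 (gt0 a))) (divfK (lt0r_neq0 (gt0 a)))
    (fun x y => ler_pM2r (gt0 a) x y).

End AffineMaps.

Section Floor.
Context {R : realType}.

Definition frac_part (t : R) : R := t - (Num.floor t)%:~R.

Lemma floor_frac (t : R) : t = (Num.floor t)%:~R + frac_part t.
Proof. by rewrite addrC subrK. Qed.

Lemma frac_part_ge0 (t : R) : 0 <= frac_part t.
Proof. by rewrite subr_ge0 floor_le. Qed.

Lemma frac_part_lt1 (t : R) : frac_part t < 1.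
Proof. by rewrite ltrBlDl -[X in _ + X]/(1%:~R) -intrD floorD1_gt. Qed.

Lemma floor_intD (n : int) (s : R) : 0 <= s < 1 -> Num.floor (n%:~R + s) = n.
Proof. by move=> s01; apply: floor_def; rewrite intrD lerDl ltrD2l. Qed.

Lemma frac_part_intD (n : int) (s : R) : 0 <= s < 1 -> frac_part (n%:~R + s) = s.
Proof. by move=> s01; rewrite /frac_part floor_intD // addrAC subrr add0r. Qed.

End Floor.

(** * Periodic extension of a bijection of the unit interval *)

Section Periodize.
Context {R : realType} (w : ibij R).
Hypotheses (w0 : w 0 = 0) (w1 : w 1 = 1).

Definition periodize_fun (p : R -> R) (t : R) : R :=
  (Num.floor t)%:~R + p (frac_part t).

(** At [s = 1] the floor jumps to [n + 1]; the two formulas agree there because [p 0 = 0] and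
    [p 1 = 1]. *)
Lemma periodize_fun_intD (p : R -> R) n s : p 0 = 0 -> p 1 = 1 -> 0 <= s <= 1 ->
  periodize_fun p (n%:~R + s) = n%:~R + p s.
Proof.
move=> p0 p1 /andP[s0]; rewrite le_eqVlt => /predU1P[->|s1].
  rewrite -[X in _ + X]/(1%:~R) -intrD -[(n + 1)%:~R]addr0 /periodize_fun.
  by rewrite floor_intD ?frac_part_intD ?lexx ?ltr01 // p0 p1 addr0 intrD.
by rewrite /periodize_fun floor_intD ?frac_part_intD ?s0.
Qed.

Lemma frac_part_fix (p : ibij R) t : p 0 = 0 -> p 1 = 1 -> 0 <= p (frac_part t) < 1.
Proof.
move=> p0 p1; rewrite -{1}p0 -[X in _ < X]p1 ibij_le ibij_lt.
by rewrite frac_part_ge0 frac_part_lt1.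
Qed.

Lemma periodize_funK : cancel (periodize_fun w) (periodize_fun w^-1%g).
Proof.
move=> t; have /andP[f0 /ltW f1] := frac_part_fix t w0 w1.
rewrite {2}/periodize_fun periodize_fun_intD ?f0 ?f1 ?(ibij_fixV w0) ?(ibij_fixV w1) //.
by rewrite ibijKE -floor_frac.
Qed.

Lemma periodize_fun_lt : {homo periodize_fun w : x y / x < y}.
Proof.
move=> x y xy; have /andP[x0 x1] := frac_part_fix x w0 w1.
have /andP[y0 y1] := frac_part_fix y w0 w1.
have := le_floor (ltW xy); rewrite le_eqVlt => /predU1P[e|].
  by rewrite /periodize_fun e ltrD2l ibij_lt /frac_part e ltrD2r.
rewrite -lezD1 -(ler_int R) intrD /periodize_fun => e.
by lra.
Qed.

End Periodize.

Section PeriodizeBij.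
Context {R : realType} (w : ibij R).
Hypotheses (w0 : w 0 = 0) (w1 : w 1 = 1).

Definition periodize : ibij R :=
  IBij (periodize_funK w0 w1)
    (@periodize_funK R w^-1%g (ibij_fixV w0) (ibij_fixV w1))
    (le_mono (periodize_fun_lt w0 w1)).

Lemma periodize_intD n s : 0 <= s <= 1 -> periodize (n%:~R + s) = n%:~R + w s.
Proof. exact: periodize_fun_intD. Qed.

Lemma periodizeV_intD n s : 0 <= s <= 1 ->
  (periodize^-1)%g (n%:~R + s) = n%:~R + (w^-1)%g s.
Proof. by apply: periodize_fun_intD; exact: ibij_fixV. Qed.

Lemma periodize_translate : commute periodize (translate (-1)).
Proof.
apply: ibijP => t; rewrite ibijM [RHS]ibijM !translateE.
rewrite [t in LHS]floor_frac [t in RHS]floor_frac addrAC -[-1]/((-1)%:~R) -intrD.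
have f01 : 0 <= frac_part t <= 1 by rewrite frac_part_ge0 ltW ?frac_part_lt1.
by rewrite !periodize_intD // intrD addrAC.
Qed.

End PeriodizeBij.

(** * A coordinate in which a bijection without fixed points is a translation *)

Section AbelCoordinate.
Context {R : realType} (T : ibij R) (lo hi y0 : R).
Hypotheses (T_lo : T lo = lo) (T_hi : T hi = hi).
Hypothesis T_gt : forall y, lo < y < hi -> y < T y.
Hypothesis y0_in : lo < y0 < hi.

(** Otherwise the orbit has a supremum inside the interval. Some iterate lies beyond the image of
    this supremum under [T^-1], and [T] sends it beyond the supremum itself. *)
Lemma orbit_up x y : lo < x < hi -> lo < y < hi -> exists n, y < (T ^+ n)%g x.
Proof.
move=> xin yin; apply: contrapT => /forallNP no.
have le_y n : (T ^+ n)%g x <= y by rewrite leNgt; apply/negP/no.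
pose E := range (fun n => (T ^+ n)%g x).
have supE : has_sup E by split; [exists x, 0%N|exists y => _ [n _ <-]].
have s_ge n : (T ^+ n)%g x <= sup E by apply: ub_le_sup => //; [exact: supE.2|exists n].
have s_le : sup E <= y by apply: ge_sup; [exact: supE.1|move=> _ [n _ <-]].
have sin : lo < sup E < hi.
  rewrite (le_lt_trans s_le) ?andbT; last by case/andP: yin.
  by rewrite (lt_le_trans _ (s_ge 0%N)) //; case/andP: xin.
have : (T^-1)%g (sup E) < sup E by rewrite -(ibij_lt T) ibijVKE T_gt.
move=> /(sup_gt supE.1)[_ [n _ <-]]; rewrite -(ibij_lt T) ibijVKE -ibijXS.
by rewrite ltNge s_ge.
Qed.

Definition int_iter (n : int) : ibij R :=
  match n with Posz m => (T ^+ m)%g | Negz m => (T ^- m.+1)%g end.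

Lemma int_iterS n : int_iter (n + 1) = (T * int_iter n)%g.
Proof.
case: n => [m|[|m]] /=.
- by rewrite addn1 expgS.
- by rewrite expg1 mulgV.
- by rewrite [in RHS]expgSr invgM mulVKg subn1.
Qed.

Lemma int_iterSr n : int_iter (n + 1) = (int_iter n * T)%g.
Proof.
rewrite int_iterS; case: n => n /=; first by rewrite -expgS expgSr.
by apply: commuteV; apply: commuteX.
Qed.

(** The cell is found from the least number of iterations leading from [y0] beyond [y], or from [y]
    up to [y0]. *)
Lemma orbit_cell y : lo < y < hi ->
  exists n, int_iter n y0 <= y < int_iter (n + 1) y0.
Proof.
move=> yin; case: (leP y0 y) => [y0y|yy0].
  case: (ex_minnP (orbit_up y0_in yin)) => -[|n]; first by rewrite ltNge y0y.
  move=> yn /(_ n) ny; exists n; rewrite int_iterS ibijM /= -ibijXS yn andbT leNgt.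
  by apply/negP => /ny; rewrite ltnn.
have [m /ltW ym] := orbit_up yin y0_in.
case: (ex_minnP (ex_intro (fun n => y0 <= (T ^+ n)%g y) m ym)) => -[|n] yn.
  by move: yy0; rewrite ltNge yn.
move=> /(_ n) ny; exists (Negz n); rewrite int_iterS [X in _ && (_ < X)]ibijM.
have TV z : (T ^+ n.+1)%g ((T ^- n.+1)%g z) = z by exact: ibijVKE.
rewrite -(ibij_le (T ^+ n.+1)%g) -[X in _ && X](ibij_lt (T ^+ n.+1)%g) /= TV yn /=.
rewrite -ibijXSr ibijXS ibijXS TV ibij_lt ltNge.
by apply/negP => /ny; rewrite ltnn.
Qed.

Lemma int_iter_fix n y : T y = y -> int_iter n y = y.
Proof.
move=> Ty; have Tn k : (T ^+ k)%g y = y by elim: k => // k IH; rewrite ibijXS IH.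
by case: n => n /=; rewrite ?Tn //; apply: ibij_fixV.
Qed.

Lemma int_iter_in n y : lo < y < hi -> lo < int_iter n y < hi.
Proof.
by rewrite -{2}(int_iter_fix n T_lo) -{2}(int_iter_fix n T_hi) !ibij_lt.
Qed.

Lemma int_iter_le m n : (m <= n)%R -> int_iter m y0 <= int_iter n y0.
Proof.
rewrite -subr_ge0 => nm; rewrite -(subrK m n).
case: (n - m) nm => // j _; elim: j => [|j IH]; first by rewrite add0r.
rewrite intS -addrA addrC int_iterS ibijM (le_trans IH) // ltW // T_gt //.
exact: int_iter_in.
Qed.

(** A solution [k] of Abel's equation [k (t + 1) = T (k t)]: it is affine from [[0, 1[] onto the
    fundamental domain [[y0, T y0[] and is propagated by the powers of [T]. *)
Definition abel_coordinate (t : R) : R :=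
  int_iter (Num.floor t) (y0 + frac_part t * (T y0 - y0)).

Lemma abel_intD n s : 0 <= s < 1 ->
  abel_coordinate (n%:~R + s) = int_iter n (y0 + s * (T y0 - y0)).
Proof. by move=> s01; rewrite /abel_coordinate floor_intD ?frac_part_intD. Qed.

Lemma abelS t : abel_coordinate (t + 1) = T (abel_coordinate t).
Proof.
have f01 : 0 <= frac_part t < 1 by rewrite frac_part_ge0 frac_part_lt1.
rewrite [in LHS](floor_frac t) addrAC -[X in _ + X + _]/(1%:~R) -intrD.
by rewrite abel_intD // int_iterS ibijM.
Qed.

Lemma abel_frac_in t : y0 <= y0 + frac_part t * (T y0 - y0) < T y0.
Proof.
have y1 := T_gt y0_in; have f0 := frac_part_ge0 t; have f1 := frac_part_lt1 t.
by apply/andP; split; nra.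
Qed.

Lemma abel_coordinate_lt : {homo abel_coordinate : x y / x < y}.
Proof.
move=> x y xy; have := le_floor (ltW xy); rewrite le_eqVlt => /predU1P[e|].
  rewrite /abel_coordinate e ibij_lt ltrD2l ltr_pM2r ?subr_gt0 ?T_gt //.
  by rewrite /frac_part e ltrD2r.
rewrite -lezD1 => /int_iter_le xy1.
have /andP[_ x1] := abel_frac_in x; have /andP[y1 _] := abel_frac_in y.
rewrite /abel_coordinate; move: x1 y1; set u := (X in X < _); set v := (X in _ <= X) => uT vT.
rewrite -(ibij_lt (int_iter (Num.floor x))) in uT.
rewrite -(ibij_le (int_iter (Num.floor y))) in vT.
apply: (lt_le_trans uT); apply: le_trans vT; apply: le_trans xy1.
by rewrite int_iterSr.
Qed.

Lemma range_abel_coordinate : range abel_coordinate = `]lo, hi[%classic.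
Proof.
rewrite eqEsubset; split=> [_ [t _ <-]|y].
  rewrite /= in_itv /=; apply: int_iter_in.
  have /andP[y0t ty1] := abel_frac_in t; have /andP[lo0 _] := y0_in.
  rewrite (lt_le_trans lo0 y0t) (lt_trans ty1) // -T_hi ibij_lt.
  by case/andP: y0_in.
rewrite /= in_itv /= => /orbit_cell[n].
set u := (int_iter n)^-1%g y.
have <- : int_iter n u = y by exact: ibijVKE.
rewrite int_iterSr ibijM ibij_le ibij_lt => /andP[y0u uy1].
have y1 := T_gt y0_in.
exists (n%:~R + (u - y0) / (T y0 - y0)) => //; rewrite abel_intD.
  by rewrite divfK ?subr_eq0 ?gt_eqF // addrC subrK.
by rewrite divr_ge0 ?subr_ge0 ?(ltW y1) //= ltr_pdivrMr ?subr_gt0 // mul1r ltrD2r.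
Qed.

End AbelCoordinate.

(** * The square root *)

(* In a coordinate where [beta] is the translation by -1, [w] is the scaling by
   sqrt 2.  It is [w^2], and not [w], that conjugates [beta] to its square because
   squares preserve the orientation in every action on a one-manifold. *)
Lemma conj_to_square {R : realType} (beta : ibij R) (lo hi : R) : lo < hi ->
  (forall y, lo < y < hi -> beta y < y) ->
  (forall y, ~~ (lo < y < hi) -> beta y = y) ->
  exists2 w : ibij R, (w * w * beta = beta * beta * w * w)%g &
    forall y, ~~ (lo < y < hi) -> w y = y.
Proof.
move=> lohi b_lt b_fix.
have T_lo : (beta^-1)%g lo = lo by apply/ibij_fixV/b_fix; rewrite ltxx.
have T_hi : (beta^-1)%g hi = hi by apply/ibij_fixV/b_fix; rewrite ltxx andbF.
have T_gt y : lo < y < hi -> y < (beta^-1)%g y by move=> /b_lt; rewrite ibij_lt_inv.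
have y0_in : lo < (lo + hi) / 2 < hi by rewrite !midf_lt.
(* [beta] moves points to the left, so the coordinate is built from its inverse. *)
pose k := abel_coordinate (beta^-1)%g ((lo + hi) / 2).
have k_le : {mono k : x y / x <= y} by exact/le_mono/(abel_coordinate_lt T_lo T_hi T_gt y0_in).
have k_range : range k = `]lo, hi[%classic by exact: range_abel_coordinate.
have k_itv : is_interval (range k) by rewrite k_range; exact: interval_is_interval.
have out y : ~~ (lo < y < hi) -> ~ range k y by move=> yo; rewrite k_range /= in_itv /=; exact/negP.
have sqrt2_gt0 : 0 < Num.sqrt 2%:R :> R by rewrite sqrtr_gt0 ltr0n.
have beta_k : beta = transport k_le k_itv (translate (-1)).
  apply: ibijP => y; case: (boolP (lo < y < hi)) => [yi|yo]; last first.
    by rewrite b_fix // transport_out //; exact: out.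
  have : range k y by rewrite k_range /= in_itv.
  move=> [t _ <-]; rewrite transport_in translateE.
  by apply: (@ibij_inj _ (beta^-1)%g); rewrite ibijKE -abelS subrK.
exists (transport k_le k_itv (scale_by (PosNum sqrt2_gt0))); last first.
  by move=> y yo; rewrite transport_out //; exact: out.
(* In the coordinate the relation reads [2 * (t - 1) = 2 * t - 2]. *)
rewrite {1 2 3}beta_k -!transportM; congr transport; apply: ibijP => t.
rewrite !ibijM !translateE /= -!mulrA.
have -> : Num.sqrt 2%:R * Num.sqrt 2%:R = 2%:R :> R by rewrite -expr2 sqr_sqrtr.
by lra.
Qed.

Section Construction.
Context {R : realType}.

Definition halving (y : R) : R :=
  if y <= 0 then y else if y <= 4 then y / 2 else y - 2.

Definition doubling (y : R) : R :=
  if y <= 0 then y else if y <= 2 then y * 2 else y + 2.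

Lemma halvingK : cancel halving doubling.
Proof. by move=> y; rewrite /halving /doubling; do !case: ifPn; lra. Qed.

Lemma doublingK : cancel doubling halving.
Proof. by move=> y; rewrite /halving /doubling; do !case: ifPn; lra. Qed.

Lemma halving_lt : {homo halving : x y / x < y}.
Proof. by move=> x y; rewrite /halving; do !case: ifPn; lra. Qed.

Definition gR : ibij R := IBij halvingK doublingK (le_mono halving_lt).

(* The identity on (-oo, 3], so that [phi0] below is the translation by -1 there. *)
Definition ray_coordinate (t : R) : R := if t <= 3 then t else 4 - (t - 2)^-1.

Lemma ray_coordinate_lt : {homo ray_coordinate : x y / x < y}.
Proof.
move=> x y xy; rewrite /ray_coordinate; case: (leP x 3) => x3; case: (leP y 3) => y3 //.
- suff : (y - 2)^-1 < 1 by lra.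
  by rewrite invf_lt1; lra.
- by lra.
- by rewrite ltrD2l ltrN2 ltf_pV2 ?posrE; lra.
Qed.

Lemma ray_coordinate_id t : t <= 3 -> ray_coordinate t = t.
Proof. by rewrite /ray_coordinate => ->. Qed.

Lemma range_ray_coordinate : range ray_coordinate = `]-oo, 4[%classic.
Proof.
rewrite eqEsubset; split=> [_ [t _ <-]|y]; rewrite /= in_itv /=.
  rewrite /ray_coordinate; case: (leP t 3) => t3; first by lra.
  by have : 0 < (t - 2)^-1; [rewrite invr_gt0; lra|lra].
move=> y4; case: (leP y 3) => y3; first by exists y; rewrite ?ray_coordinate_id.
exists (2 + (4 - y)^-1) => //; rewrite /ray_coordinate.
have z1 : 1 < (4 - y)^-1 by rewrite invf_gt1; lra.
rewrite ifF; last by lra.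
have -> : 2 + (4 - y)^-1 - 2 = (4 - y)^-1 by lra.
by rewrite invrK; lra.
Qed.

Lemma ray_coordinate_itv : is_interval (range ray_coordinate).
Proof. by rewrite range_ray_coordinate; exact: interval_is_interval. Qed.

Definition on_ray : ibij R -> ibij R := transport (le_mono ray_coordinate_lt) ray_coordinate_itv.

Lemma on_rayM : {morph on_ray : p q / (p * q)%g}.
Proof. exact: transportM. Qed.

Lemma on_ray_out (p : ibij R) (y : R) : 4 <= y -> on_ray p y = y.
Proof.
by move=> y4; rewrite transport_out // range_ray_coordinate /= in_itv /= ltNge y4.
Qed.

Lemma on_ray_id (p : ibij R) (y : R) : y <= 3 -> p y <= 3 -> on_ray p y = p y.
Proof.
by move=> y3 py3; rewrite -{1}[y]ray_coordinate_id // /on_ray transport_in ray_coordinate_id.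
Qed.

Lemma on_ray_lt (p : ibij R) (y : R) : (forall t, p t < t) -> y < 4 -> on_ray p y < y.
Proof.
move=> p_lt y4; have : range ray_coordinate y by rewrite range_ray_coordinate /= in_itv.
by move=> [t _ <-]; rewrite /on_ray transport_in ray_coordinate_lt.
Qed.

Definition phi0 : ibij R := on_ray (translate (-1)).

Lemma phi0_id y : y <= 3 -> phi0 y = y - 1.
Proof. by move=> y3; rewrite /phi0 on_ray_id ?translateE //; lra. Qed.

Lemma phi0_lt y : y < 4 -> phi0 y < y.
Proof. by apply: on_ray_lt => t; rewrite translateE; lra. Qed.

Lemma phi0_out y : 4 <= y -> phi0 y = y.
Proof. exact: on_ray_out. Qed.

Lemma gR_fix y : y <= 0 -> gR y = y.
Proof. by rewrite /= /halving => ->. Qed.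

Lemma gR_half y : 0 <= y <= 4 -> gR y = y / 2.
Proof. by rewrite /= /halving; do !case: ifPn; lra. Qed.

Lemma gR_shift y : 4 <= y -> gR y = y - 2.
Proof. by rewrite /= /halving; do !case: ifPn; lra. Qed.

Lemma gR_lt y : 0 < y -> gR y < y.
Proof. by rewrite /= /halving; do !case: ifPn; lra. Qed.

Lemma gR2_fix y : y <= 0 -> (gR ^+ 2)%g y = y.
Proof. by move=> y0; rewrite expgS expg1 ibijM !gR_fix. Qed.

Lemma gR2_lt y : 0 < y -> (gR ^+ 2)%g y < y.
Proof.
move=> y0; rewrite expgS expg1 ibijM; apply: lt_trans (gR_lt y0).
by rewrite gR_lt // -(gR_fix (lexx 0)) ibij_lt.
Qed.

(** This is the hypothesis [ABc] for [c = 4] and [d = 0]: the point 4 goes to 2, 1 and then 0. *)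
Lemma phi0_gR2_4 : phi0 ((gR ^+ 2)%g 4) <= 0.
Proof.
rewrite expgS expg1 ibijM [gR 4]gR_half; last lra.
rewrite gR_half; last lra.
by rewrite phi0_id; lra.
Qed.

(** A commutator supported in []0, 8[]: [gR ^+ 2] is the identity to the left of 0, and [phi0] is
    the identity to the right of 4, the image of 8 under [gR ^+ 2]. *)
Definition kappa : ibij R := (phi0^-1 * (gR ^+ 2)^-1 * phi0 * gR ^+ 2)%g.

(** The conjugation shrinks the support to []0, 1/2[], as [gR] sends 8 successively to 6, 4, 2, 1
    and 1/2. *)
Definition beta : ibij R := (kappa ^ (gR ^- 5))%g.

Lemma gR5_8 : (gR ^+ 5)%g 8 = 2^-1.
Proof.
have g8 : gR 8 = 6 by rewrite gR_shift; lra.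
have g6 : gR 6 = 4 by rewrite gR_shift; lra.
have g4 : gR 4 = 2 by rewrite gR_half; lra.
have g2 : gR 2 = 1 by rewrite gR_half; lra.
by rewrite !ibijXS expg0 ibij1 g8 g6 g4 g2 gR_half; lra.
Qed.

Lemma gR2_8 : (gR ^+ 2)%g 8 = 4.
Proof.
rewrite expgS expg1 ibijM [gR 8]gR_shift; last lra.
by rewrite gR_shift; lra.
Qed.

Lemma kappaE y : kappa y = (phi0^-1)%g ((gR ^- 2)%g (phi0 ((gR ^+ 2)%g y))).
Proof. by []. Qed.

Lemma kappa_fix y : ~~ (0 < y < 8) -> kappa y = y.
Proof.
rewrite negb_and -!leNgt kappaE => /orP[y0|y8].
  rewrite (gR2_fix y0) (ibij_fixV (gR2_fix _)) ?ibijKE //.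
  by rewrite phi0_id; lra.
have y4 : 4 <= (gR ^+ 2)%g y by rewrite -gR2_8 ibij_le.
rewrite (phi0_out y4) ibijKE; apply/ibij_fixV/phi0_out.
by rewrite (le_trans _ y8) //; lra.
Qed.

(** The claim amounts to comparing [phi0] after [gR ^+ 2] with [gR ^+ 2] after [phi0]. Either [phi0]
    fixes [y], or [gR ^+ 2] fixes [phi0 y], or 0 separates the two values. *)
Lemma kappa_lt y : 0 < y < 8 -> kappa y < y.
Proof.
move=> /andP[y0 y8]; rewrite kappaE ibij_lt_inv invgK ibij_lt_inv invgK.
have gy : (gR ^+ 2)%g y < 4 by rewrite -gR2_8 ibij_lt.
case: (ltP y 4) => [y4|y4]; last by rewrite (phi0_out y4) phi0_lt.
case: (leP (phi0 y) 0) => py; first by rewrite [ltRHS]gR2_fix // ibij_lt gR2_lt.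
apply: (@le_lt_trans _ _ 0); last by rewrite -[ltLHS](gR2_fix (lexx 0)) ibij_lt.
by apply: le_trans phi0_gR2_4; rewrite !ibij_le ltW.
Qed.

Lemma betaE y : beta y = (gR ^+ 5)%g (kappa ((gR ^- 5)%g y)).
Proof. by rewrite /beta /conjg invgK. Qed.

Lemma gR5_range y : (0 < (gR ^- 5)%g y < 8) = (0 < y < 2^-1).
Proof.
have g0 : (gR ^+ 5)%g 0 = 0 by rewrite !ibijXS expg0 ibij1 !gR_fix.
rewrite -(ibij_lt (gR ^+ 5)%g 0) -(ibij_lt (gR ^+ 5)%g _ 8).
by rewrite g0 gR5_8 [(gR ^+ 5)%g _]ibijVKE.
Qed.

Lemma beta_fix y : ~~ (0 < y < 2^-1) -> beta y = y.
Proof. by rewrite -gR5_range betaE => /kappa_fix ->; exact: ibijVKE. Qed.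

Lemma beta_lt y : 0 < y < 2^-1 -> beta y < y.
Proof. by rewrite -gR5_range => /kappa_lt y_lt; rewrite betaE ibij_lt_inv. Qed.

Lemma beta_segment s : (0 <= beta s <= 2^-1) = (0 <= s <= 2^-1).
Proof. by apply: ibij_segment; apply: beta_fix; rewrite ltxx ?andbF. Qed.

Local Opaque phi0 kappa beta gR.

(** * A square root of [phi0] depending on a parameter [w] *)

Section RootOfTranslation.
Variable w : ibij R.
Hypothesis w_fix : forall y, ~~ (0 < y < 2^-1) -> w y = y.

Lemma w_fix0 : w 0 = 0. Proof. by rewrite w_fix ?ltxx. Qed.
Lemma w_fix1 : w 1 = 1. Proof. by rewrite w_fix // negb_and -!leNgt; apply/orP; right; lra. Qed.

Lemma wV_segment s : (0 <= (w^-1)%g s <= 2^-1) = (0 <= s <= 2^-1).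
Proof. by apply/ibij_segment/ibij_fixV/w_fix; [exact: ibij_fixV w_fix0|rewrite ltxx andbF]. Qed.

(* [periodize w] commutes with the translation by -1, so this is a square root of
   that translation; it depends on [w] while its square does not. *)
Definition root_translation : ibij R :=
  let W := periodize w_fix0 w_fix1 in (W * translate (- 2^-1) * W^-1)%g.

Lemma root_translation_sq : (root_translation ^+ 2 = translate (-1))%g.
Proof.
rewrite expgS expg1 /root_translation !mulgA mulgVK -(mulgA _ (translate _) (translate _)).
have -> : (translate (- 2^-1) * translate (- 2^-1))%g = translate (-1) :> ibij R.
  by rewrite translateM; congr translate; lra.
set W := periodize _ _.
by rewrite (periodize_translate w_fix0 w_fix1) mulgK.
Qed.

Lemma root_translation_lt t : root_translation t < t.
Proof.
rewrite /root_translation !ibijM; set W := periodize _ _.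
by rewrite -[ltRHS](ibijVKE W t) ibij_lt translateE; lra.
Qed.

(** The inverse of the periodized [w] acts on [[1, 3/2]] through [w^-1]; the shift by -1/2 then
    leads into [[1/2, 1]], where [w] is the identity. *)
Lemma root_translation_in y : 1 <= y <= 1 + 2^-1 ->
  root_translation y = 2^-1 + (w^-1)%g (y - 1).
Proof.
move=> y1; rewrite /root_translation !ibijM.
rewrite {1}(_ : y = 1%:~R + (y - 1)); last by rewrite addrC subrK.
rewrite periodizeV_intD; last by lra.
have : 0 <= (w^-1)%g (y - 1) <= 2^-1 by rewrite wV_segment; lra.
move: ((w^-1)%g (y - 1)) => s /andP[s0 s1].
rewrite translateE.
have -> : 1%:~R + s - 2^-1 = 0%:~R + (2^-1 + s) by lra.
rewrite periodize_intD; last by lra.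
rewrite w_fix; last by rewrite negb_and -!leNgt; apply/orP; right; lra.
by rewrite add0r.
Qed.

Definition fR : ibij R := on_ray root_translation.

Lemma fR_sq : (fR ^+ 2 = phi0)%g.
Proof.
by have := root_translation_sq; rewrite !expgS !expg0 !mulg1 -on_rayM => ->.
Qed.

Lemma fR_lt y : y < 4 -> fR y < y.
Proof. exact/on_ray_lt/root_translation_lt. Qed.

Lemma fR_fix y : 4 <= y -> fR y = y.
Proof. exact: on_ray_out. Qed.

Lemma thompson_fR_gR : isomorphic thompsonF (generated [set (fR ^+ 2)%g; (gR ^+ 2)%g]).
Proof.
rewrite fR_sq; apply: (@chain_isomorphic _ _ _ 4 0).
- exact: phi0_lt.
- exact: phi0_out.
- exact: gR2_fix.
- exact: gR2_lt.
- by lra.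
- exact: phi0_gR2_4.
Qed.

Hypothesis w_beta : (w * w * beta = beta * beta * w * w)%g.

(** [phi0] carries [[1, 3/2]] onto [[0, 1/2]], so this is a copy of [beta] on the former
    interval. *)
Definition small_bump : ibij R := (beta ^ phi0)%g.

(* On [1/2, 1] the factor in front of [fR] is x |-> 2x |-> 2x + 1 |-> x + 1/2; it
   brings the image under [fR] of the interval [1, 3/2] back to [1, 3/2]. *)
Definition root_conjugator : ibij R := (gR * phi0^-1 * gR^-1 * fR)%g.

Lemma phi0V_id y : y <= 2 -> (phi0^-1)%g y = y + 1.
Proof.
by move=> y2; apply: (@ibij_inj _ phi0); rewrite ibijVKE phi0_id; lra.
Qed.

Lemma small_bumpE y : small_bump y = if 1 <= y <= 1 + 2^-1 then 1 + beta (y - 1) else y.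
Proof.
rewrite /small_bump ibij_conj; case: ifPn => [y1|]; last first.
  rewrite negb_and -!ltNge => y_out.
  have phi_out : ~~ (0 < phi0 y < 2^-1).
    rewrite negb_and -!leNgt; case/orP: y_out => y1.
      by rewrite phi0_id; lra.
    have e : phi0 (1 + 2^-1) = 2^-1 by rewrite phi0_id; lra.
    by apply/orP; right; rewrite -e ibij_le; exact: ltW.
  by rewrite (beta_fix phi_out); exact: ibijKE.
rewrite phi0_id; last by lra.
have : 0 <= beta (y - 1) <= 2^-1 by rewrite beta_segment; lra.
by move: (beta (y - 1)) => s s1; rewrite phi0V_id; lra.
Qed.

Lemma root_conjugatorE y : 1 <= y <= 1 + 2^-1 ->
  root_conjugator y = 1 + (w^-1)%g (y - 1).
Proof.
move=> y1; rewrite /root_conjugator !ibijM.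
have s_in : 0 <= (w^-1)%g (y - 1) <= 2^-1 by rewrite wV_segment; lra.
have -> : fR y = 2^-1 + (w^-1)%g (y - 1).
  have r_in := root_translation_in y1.
  by rewrite -r_in; apply: on_ray_id; rewrite ?r_in; lra.
move: ((w^-1)%g (y - 1)) s_in => s s_in.
have -> : (gR^-1)%g (2^-1 + s) = 1 + 2 * s.
  by apply: (@ibij_inj _ gR); rewrite ibijVKE gR_half; lra.
rewrite phi0V_id; last by lra.
by rewrite gR_half; lra.
Qed.

(** In the coordinate [s = y - 1] on [[1, 3/2]], [small_bump] is [beta] and [root_conjugator] is
    [w^-1], so the relation is [w_beta] rewritten for [w^-1]. The complement is preserved by
    [root_conjugator] and fixed pointwise by [small_bump]. *)
Lemma bump_root_conjugator :
  (small_bump * root_conjugator ^+ 2 = root_conjugator ^+ 2 * small_bump ^+ 2)%g.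
Proof.
have half_fix : w 2^-1 = 2^-1 by rewrite w_fix // ltxx andbF.
have zs s : 0 <= s <= 2^-1 -> root_conjugator (1 + s) = 1 + (w^-1)%g s.
  by move=> s1; rewrite root_conjugatorE; [rewrite addrAC subrr add0r|lra].
have bs s : 0 <= s <= 2^-1 -> small_bump (1 + s) = 1 + beta s.
  by move=> s1; rewrite small_bumpE ifT; [rewrite addrAC subrr add0r|lra].
have key : (beta * w^-1 * w^-1 = w^-1 * w^-1 * beta * beta)%g.
  move: beta w_beta => b b_w.
  apply: (mulgI w); apply: (mulgI w); apply: (mulIg w); apply: (mulIg w).
  by rewrite !mulgA !mulgVK mulgK mulgV mul1g b_w.
have z_lo : root_conjugator 1 = 1.
  by have := zs 0; rewrite (ibij_fixV w_fix0) !addr0; apply; lra.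
have z_hi : root_conjugator (1 + 2^-1) = 1 + 2^-1.
  by rewrite zs ?(ibij_fixV half_fix) //; lra.
apply: ibijP => y; rewrite !expgS !expg0 !mulg1.
rewrite -[LHS]/(small_bump (root_conjugator (root_conjugator y))).
rewrite -[RHS]/(root_conjugator (root_conjugator (small_bump (small_bump y)))).
case: (boolP (1 <= y <= 1 + 2^-1)) => [y1|yo].
  have -> : y = 1 + (y - 1) by rewrite addrC subrK.
  have : 0 <= y - 1 <= 2^-1 by lra.
  move: (y - 1) => s s1.
  rewrite !(zs, bs) ?wV_segment ?beta_segment //; congr (1 + _).
  exact: (congr1 (fun p : ibij R => p s) key).
have b_out u : ~~ (1 <= u <= 1 + 2^-1) -> small_bump u = u by rewrite small_bumpE => /negbTE ->.
have z_out u : ~~ (1 <= u <= 1 + 2^-1) -> ~~ (1 <= root_conjugator u <= 1 + 2^-1).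
  by rewrite (ibij_segment _ z_lo z_hi).
by rewrite !b_out // ?z_out.
Qed.

End RootOfTranslation.

End Construction.

(** * Transfer to the unit interval *)

Section UnitInterval.
Context {R : realType}.
Implicit Types (p q : ibij R) (x : unit_interval R).

Lemma ibij_continuous (f : ibij R) : continuous f.
Proof.
move=> x; apply/cvgrPdist_lt => e e0.
have inv_lt u v : ((f^-1)%g u < v) = (u < f v) by rewrite ibij_lt_inv invgK.
have : x \in `](f^-1)%g (f x - e), (f^-1)%g (f x + e)[.
  have : (f^-1)%g (f x - e) < x < (f^-1)%g (f x + e) by rewrite inv_lt -ibij_lt_inv; lra.
  by rewrite in_itv.
move=> /near_in_itvoo; apply: filterS => y; rewrite in_itv => /andP[].
rewrite -[X in X -> _]/(is_true ((f^-1)%g (f x - e) < y)) inv_lt => y1.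
rewrite -[X in X -> _]/(is_true (y < (f^-1)%g (f x + e))) -ibij_lt_inv => y2.
by rewrite ltr_norml; lra.
Qed.

Definition unit_coordinate (t : R) : R :=
  if t <= 0 then (2 - t)^-1 else 1 - (2 + t)^-1.

Lemma unit_coordinate_lt : {homo unit_coordinate : x y / x < y}.
Proof.
have inv_lt_half (t : R) : 0 < t -> (2 + t)^-1 < 2^-1 by move=> t0; rewrite ltf_pV2 ?posrE; lra.
move=> x y xy; rewrite /unit_coordinate; case: (leP x 0) => x0; case: (leP y 0) => y0.
- by rewrite ltf_pV2 ?posrE; lra.
- have := inv_lt_half _ y0; suff : (2 - x)^-1 <= 2^-1 by lra.
  by rewrite lef_pV2 ?posrE; lra.
- by lra.
- by rewrite ltrD2l ltrN2 ltf_pV2 ?posrE; lra.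
Qed.

Lemma range_unit_coordinate : range unit_coordinate = `]0, 1[%classic.
Proof.
rewrite eqEsubset; split=> [_ [t _ <-]|y]; rewrite /= in_itv /=.
  rewrite /unit_coordinate; case: (leP t 0) => t0.
    by rewrite invr_gt0 invf_lt1; lra.
  have : 0 < (2 + t)^-1 by rewrite invr_gt0; lra.
  by have : (2 + t)^-1 < 1 by [rewrite invf_lt1; lra|]; lra.
move=> /andP[y0 y1]; case: (leP y 2^-1) => y2.
  exists (2 - y^-1) => //; rewrite /unit_coordinate ifT.
    by rewrite opprB addrC subrK invrK.
  by rewrite subr_le0 -[X in X <= _]invrK lef_pV2 ?posrE //; lra.
exists ((1 - y)^-1 - 2) => //; rewrite /unit_coordinate ifF.
  by rewrite [2 + _]addrC subrK invrK; lra.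
apply/negbTE; rewrite -ltNge subr_gt0 -[X in X < _]invrK ltf_pV2 ?posrE //; lra.
Qed.

Lemma unit_coordinate_itv : is_interval (range unit_coordinate).
Proof. by rewrite range_unit_coordinate; exact: interval_is_interval. Qed.

Lemma unit_coordinate_in t : 0 < unit_coordinate t < 1.
Proof.
have : range unit_coordinate (unit_coordinate t) by exists t.
by rewrite range_unit_coordinate /= in_itv.
Qed.

(** The result is again an increasing bijection of the whole line, so [ibij_continuous] also covers
    continuity at 0 and 1. *)
Definition on_unit : ibij R -> ibij R :=
  transport (le_mono unit_coordinate_lt) unit_coordinate_itv.

Lemma on_unit_out p y : ~~ (0 < y < 1) -> on_unit p y = y.
Proof.
move=> y01; rewrite /on_unit transport_out // range_unit_coordinate /= in_itv /=.
exact/negP.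
Qed.

Lemma on_unit_in01 p y : 0 <= y <= 1 -> `[0, 1]%classic (on_unit p y).
Proof.
have p0 : on_unit p 0 = 0 by rewrite on_unit_out ?ltxx.
have p1 : on_unit p 1 = 1 by rewrite on_unit_out ?ltxx ?andbF.
by rewrite -(ibij_segment _ p0 p1) => y01; rewrite /= in_itv.
Qed.

Lemma unit_interval_in x : 0 <= set_val x <= 1.
Proof. by have := set_valP x; rewrite /= in_itv. Qed.

Definition unit_homeo_fun p x : unit_interval R :=
  SigSub (mem_set (on_unit_in01 p (unit_interval_in x))).

Lemma unit_homeo_funE p x : set_val (unit_homeo_fun p x) = on_unit p (set_val x).
Proof. by []. Qed.

Lemma set_val_inj : injective (set_val : unit_interval R -> R).
Proof. exact: val_inj. Qed.

Lemma unit_homeo_funK p : cancel (unit_homeo_fun p) (unit_homeo_fun p^-1%g).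
Proof.
move=> x; apply: set_val_inj; rewrite !unit_homeo_funE.
exact: (transport_funK (le_mono unit_coordinate_lt)).
Qed.

Lemma unit_homeo_funVK p : cancel (unit_homeo_fun p^-1%g) (unit_homeo_fun p).
Proof. by rewrite -{2}(invgK p); exact: unit_homeo_funK. Qed.

Lemma unit_homeo_continuous p : continuous (unit_homeo_fun p).
Proof.
apply: continuous_comp_initial => x.
apply: (@continuous_comp _ _ _ set_val (on_unit p)); last exact: ibij_continuous.
exact: initial_continuous.
Qed.

Definition unit_homeo p : homeo (unit_interval R) :=
  Homeo (unit_homeo_funK p) (unit_homeo_funVK p)
    (@unit_homeo_continuous p) (@unit_homeo_continuous p^-1%g).

Lemma unit_homeoE p x : set_val (unit_homeo p x) = on_unit p (set_val x).
Proof. by []. Qed.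

Lemma unit_homeoM : {morph unit_homeo : p q / (p * q)%g}.
Proof.
move=> p q; apply: homeoP => x; apply: set_val_inj.
by rewrite [LHS]unit_homeoE /on_unit transportM.
Qed.

Lemma unit_homeo_plus p : homeo_plus (unit_homeo p).
Proof. by move=> x y xy; rewrite !unit_homeoE ibij_le. Qed.

Lemma on_unit_in p t : on_unit p (unit_coordinate t) = unit_coordinate (p t).
Proof. exact: transport_in. Qed.

Definition unit_point (t : R) : unit_interval R.
Proof.
apply: (@SigSub _ _ _ (unit_coordinate t)); apply/mem_set.
by have /andP[t0 t1] := unit_coordinate_in t; rewrite /= in_itv /= !ltW.
Defined.

Lemma unit_pointE t : set_val (unit_point t) = unit_coordinate t.
Proof. by []. Qed.

Lemma supp_unit_homeo p :
  supp (unit_homeo p) = unit_coordinate @` [set t | p t != t].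
Proof.
have k_inj : injective unit_coordinate := inc_inj (le_mono unit_coordinate_lt).
rewrite eqEsubset; split=> [_ [x px <-]|_ [t pt <-]].
  have [[t _ tx]|xo] := pselect (range unit_coordinate (set_val x)); last first.
    move: px => /= /eqP[]; apply: set_val_inj; rewrite unit_homeoE.
    by rewrite /on_unit transport_out.
  exists t => //; apply: contra_neq px => pt; apply: set_val_inj.
  by rewrite unit_homeoE -tx /on_unit transport_in pt.
exists (unit_point t) => //=.
apply: contra_neq pt => /(congr1 set_val).
by rewrite unit_homeoE unit_pointE on_unit_in => /k_inj.
Qed.

Lemma unit_homeo_inj : injective unit_homeo.
Proof.
move=> p q pq; apply: ibijP => t.
have := congr1 (fun h : homeo _ => set_val (h (unit_point t))) pq.
rewrite !unit_homeoE unit_pointE !on_unit_in.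
exact: (inc_inj (le_mono unit_coordinate_lt)).
Qed.

Lemma two_chain_unit_homeo p q (c d : R) : d < c ->
  [set t | p t != t] = `]-oo, c[%classic -> [set t | q t != t] = `]d, +oo[%classic ->
  two_chain (supp (unit_homeo p)) (supp (unit_homeo q)).
Proof.
move=> dc pc qd.
have k_lt : {mono unit_coordinate : x y / x < y} := leW_mono (le_mono unit_coordinate_lt).
have pre y : 0 < y < 1 -> exists t, unit_coordinate t = y.
  move=> y01; have : range unit_coordinate y by rewrite range_unit_coordinate /= in_itv.
  by move=> [t _ <-]; exists t.
have sp : supp (unit_homeo p) = `]0, unit_coordinate c[%classic.
  rewrite supp_unit_homeo pc eqEsubset; split=> [_ [t + <-]|y]; rewrite /= !in_itv /=.
    by move=> tc; rewrite k_lt tc andbT; case/andP: (unit_coordinate_in t).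
  have /andP[_ c1] := unit_coordinate_in c.
  move=> /andP[y0 yc]; have [|t ty] := pre y; first by rewrite y0 (lt_trans yc).
  by exists t => //; rewrite in_itv /= -k_lt ty.
have sq : supp (unit_homeo q) = `]unit_coordinate d, 1[%classic.
  rewrite supp_unit_homeo qd eqEsubset; split=> [_ [t + <-]|y]; rewrite /= !in_itv /=.
    by rewrite andbT => td; rewrite k_lt td; case/andP: (unit_coordinate_in t).
  have /andP[d0 _] := unit_coordinate_in d.
  move=> /andP[yd y1]; have [|t ty] := pre y; first by rewrite (lt_trans d0).
  by exists t => //; rewrite in_itv /= -k_lt ty yd.
have /andP[c0 c1] := unit_coordinate_in c; have /andP[d0 d1] := unit_coordinate_in d.
have kdc : unit_coordinate d < unit_coordinate c by rewrite k_lt.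
have sI : `]0, unit_coordinate c[%classic `&` `]unit_coordinate d, 1[%classic =
    `]unit_coordinate d, unit_coordinate c[%classic.
  rewrite eqEsubset; split=> y; rewrite /= !in_itv /=; first by move=> [/andP[_ ->] /andP[->]].
  by move=> /andP[dy yc]; rewrite dy yc (lt_trans d0 dy) (lt_trans yc c1).
rewrite /two_chain sp sq sI; split.
- by exists (0, unit_coordinate c).
- by exists (unit_coordinate d, 1).
- split; first exact: interval_is_interval.
  by exists ((unit_coordinate d + unit_coordinate c) / 2); rewrite /= in_itv /= !midf_lt.
(* Strictness is witnessed by the end point of each interval that lies in the other one. *)
- split; first by rewrite -sI; exact: subIsetl.
  by move=> /(_ (unit_coordinate d)); rewrite /= !in_itv /= ltxx d0 kdc => /(_ isT).
- split; first by rewrite -sI; exact: subIsetr.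
  by move=> /(_ (unit_coordinate c)); rewrite /= !in_itv /= ltxx c1 kdc => /(_ isT).
Qed.

End UnitInterval.

(** * Germs of piecewise linear maps *)

Lemma count_lt (T : eqType) (a b : pred T) (s : seq T) x :
  subpred a b -> x \in s -> b x -> ~~ a x -> (count a s < count b s)%N.
Proof.
move=> ab + bx ax; elim: s => // y s IH; rewrite in_cons /= => /predU1P[<-|/IH].
  by rewrite bx (negbTE ax) ltnS sub_count.
by rewrite -addnS; apply: leq_add; case: (a y) (ab y) => // /(_ isT) ->.
Qed.

(** The number of entries of [s] of measure below [m k] drops at each step: [k'] is counted for [k]
    but not for itself. *)
Lemma no_finite_descent (R : realDomainType) (T : eqType) (s : seq T)
    (P : T -> Prop) (m : T -> R) :
  (forall k, P k -> k \in s) ->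
  (forall k, P k -> exists2 k', P k' & m k' < m k) -> forall k, ~ P k.
Proof.
move=> Ps desc k.
have [n] := ubnP (count (fun y => m y < m k) s); elim: n k => // n IH k kn Pk.
have [k' Pk' k'k] := desc _ Pk; apply: (IH k') => //.
rewrite -ltnS; apply: leq_trans kn; rewrite ltnS.
apply: (@count_lt _ _ _ _ k') => //; [|exact: Ps|by rewrite ltxx].
by move=> y /= /lt_trans; apply.
Qed.

Section Germs.
Context {R : realType}.
Implicit Types (F G A B : R -> R) (S : seq R) (p t k l e : R).

Definition right_germ F p k := exists2 e, 0 < e & forall t, 0 <= t <= e -> F (p + t) = F p + k * t.

Definition left_germ F p l := exists2 e, 0 < e & forall t, 0 <= t <= e -> F (p - t) = F p - l * t.

(** Only the slopes are finite in number, not the break points, so that lifts of piecewise linear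
    circle maps are covered. *)
Definition germs_in S F := forall p,
  (exists2 k, k \in S & right_germ F p k) /\ (exists2 l, l \in S & left_germ F p l).

Lemma small_scale k e : 0 < e -> exists2 e', 0 < e' & forall t, 0 <= t <= e' -> 0 <= `|k| * t <= e.
Proof.
move=> e0; have k1 : 0 < 1 + `|k| by rewrite ltr_pwDl.
exists (e / (1 + `|k|)); first exact: divr_gt0.
move=> t /andP[t0]; rewrite ler_pdivlMr // => te; rewrite mulr_ge0 //=.
by rewrite (le_trans _ te) // mulrDr mulr1 mulrC lerDr.
Qed.

(** A negative slope of [F] reverses the side from which [F p] is approached, and then the left germ
    of [G] matters. *)
Lemma right_germ_comp F G p k k' l' : right_germ F p k ->
  right_germ G (F p) k' -> left_germ G (F p) l' ->
  right_germ (G \o F) p ((if 0 <= k then k' else l') * k).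
Proof.
move=> [e e0 Fe] [e1 e10 Ge1] [e2 e20 Ge2].
have [e3 e30 ke3] : exists2 e3, 0 < e3 & forall t, 0 <= t <= e3 -> 0 <= `|k| * t <= Num.min e1 e2.
  by apply: small_scale; rewrite lt_min e10.
exists (Num.min e e3); first by rewrite lt_min e0.
move=> t /andP[t0]; rewrite le_min => /andP[te te3] /=; rewrite Fe ?t0 //.
have := ke3 t; rewrite t0 te3 => /(_ isT) /andP[kt0]; rewrite le_min => /andP[kt1 kt2].
case: (ger0P k) kt0 kt1 kt2 => k0 kt0 kt1 kt2; first by rewrite Ge1 ?kt0 // mulrA.
by have -> : F p + k * t = F p - (- k * t) by [lra|]; rewrite Ge2 ?kt0 //; lra.
Qed.

Lemma mirror_germ F p l : left_germ F p l <-> right_germ (fun t => F (- t)) (- p) (- l).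
Proof.
by split=> -[e e0 Fe]; exists e => // t /Fe; rewrite ?opprD ?opprK mulNr.
Qed.

Lemma left_germ_comp F G p l k' l' : left_germ F p l ->
  right_germ G (F p) k' -> left_germ G (F p) l' ->
  left_germ (G \o F) p ((if l <= 0 then k' else l') * l).
Proof.
move=> /mirror_germ Fl Gk Gl; apply/mirror_germ.
have := right_germ_comp Fl; rewrite opprK => /(_ _ _ _ Gk Gl).
by rewrite oppr_ge0 mulrN.
Qed.

Lemma germs_comp S S' F G : germs_in S F -> germs_in S' G ->
  germs_in [seq x * y | x <- S', y <- S] (G \o F).
Proof.
move=> FS GS p; have [[k kS Fk] [l lS Fl]] := FS p.
have [[k' kS' Gk] [l' lS' Gl]] := GS (F p); split.
- exists ((if 0 <= k then k' else l') * k); last exact: right_germ_comp.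
  by apply/allpairsP; exists (if 0 <= k then k' else l', k); split => //; case: ifP.
- exists ((if l <= 0 then k' else l') * l); last exact: left_germ_comp.
  by apply/allpairsP; exists (if l <= 0 then k' else l', l); split => //; case: ifP.
Qed.

Lemma right_germ_gt0 F p k : {homo F : x y / x < y} -> right_germ F p k -> 0 < k.
Proof.
move=> F_lt [e e0 Fe].
have /F_lt : p < p + e by lra.
by rewrite Fe ?lexx ?ltW // ltrDl pmulr_lgt0.
Qed.

(* [p] is a fixed point at the left end of a component of the support of [B]. *)
Lemma germ_at_boundary S B x : germs_in S B -> {homo B : x y / x < y} ->
  (exists2 q, q <= x & B q = q) -> B x <> x ->
  exists p k, [/\ B p = p, right_germ B p k, k \in S & k != 1].
Proof.
move=> BS B_lt [q qx Bq] Bx.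
pose E := [set y | y <= x /\ B y = y].
have supE : has_sup E by split; [exists q|exists x => y []].
have E_le y : E y -> y <= sup E by move=> Ey; apply: ub_le_sup => //; exact: supE.2.
have sx : sup E <= x by apply: ge_sup; [exact: supE.1|move=> y []].
have [[k kS [e e0 Be]] [l _ [e' e'0 Be']]] := BS (sup E).
have Bs : B (sup E) = sup E.
  (* If the supremum is not attained, the affine piece to its left contains two fixed points, so it
     has slope 1 and is the identity up to [sup E]. *)
  have [y1 Ey1 sy1] : exists2 y, E y & sup E - e' < y by apply: sup_gt; [exact: supE.1|lra].
  have y1s := E_le _ Ey1; have [y1x By1] := Ey1.
  move: y1s; rewrite le_eqVlt => /predU1P[<-//|y1s].
  have [y2 Ey2 y12] := sup_gt supE.1 y1s.
  have y2s := E_le _ Ey2; have [y2x By2] := Ey2.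
  have b y : sup E - e' < y -> y <= sup E -> B y = B (sup E) - l * (sup E - y).
    by move=> y_lo y_hi; rewrite -Be'; [congr B; lra|lra].
  have := b _ sy1 (ltW y1s); have := b _ (lt_trans sy1 y12) y2s; rewrite By1 By2 => e2 e1.
  have : (l - 1) * (y2 - y1) = 0 by lra.
  by move=> /eqP; rewrite mulf_eq0 => /orP[] /eqP; nra.
exists (sup E), k; split => //; first by exists e.
(* With right slope 1, [B] would fix a point of []sup E, x]]. *)
apply/eqP => k1.
have sx' : sup E < x by rewrite lt_neqAle sx andbT; apply/eqP => sE; apply: Bx; rewrite -sE.
pose t := Num.min e (x - sup E).
have t0 : 0 < t by rewrite lt_min e0 subr_gt0.
have te : t <= e by rewrite ge_min lexx.
have tx : t <= x - sup E by rewrite ge_min lexx orbT.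
have : E (sup E + t) by split; [lra|rewrite Be; [rewrite Bs k1; lra|lra]].
by move=> /E_le; lra.
Qed.

Lemma double_fix B y : {homo B : x y / x < y} -> B (B y) = y -> B y = y.
Proof.
move=> B_lt BBy; apply/eqP; case: ltgtP => // [y1|y1].
  by have := B_lt _ _ y1; rewrite BBy; lra.
by have := B_lt _ _ y1; rewrite BBy; lra.
Qed.

(** At [p + t] the relation reads [a * k * t = k' ^+ 2 * a * t], where [t] is so small that [t],
    [k * t], [a * t] and [a * k' * t] stay within the affine pieces concerned. *)
Lemma germ_conj A B p a k k' :
  {homo A : x y / x < y} -> {homo B : x y / x < y} -> (forall t, A (B t) = B (B (A t))) ->
  B p = p -> right_germ A p a -> right_germ B p k -> B (A p) = A p ->
  right_germ B (A p) k' -> k = k' ^+ 2.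
Proof.
move=> A_lt B_lt AB Bp gA gB BAp gB'.
have a0 := right_germ_gt0 A_lt gA; have k0 := right_germ_gt0 B_lt gB.
have k'0 := right_germ_gt0 B_lt gB'.
case: gA gB gB' => ea ea0 gA [e e0 gB] [e' e'0 gB'].
pose t := Num.min (Num.min e ea) (Num.min (ea / k) (Num.min (e' / a) (e' / (a * k')))).
have t0 : 0 < t by rewrite !lt_min e0 ea0 !divr_gt0 // mulr_gt0.
have : t <= t by [].
rewrite {2}/t !le_min => /andP[/andP[te tea] /andP[]].
rewrite ler_pdivlMr // => tk /andP[]; rewrite ler_pdivlMr // => ta.
rewrite ler_pdivlMr ?mulr_gt0 // => tak.
have := AB (p + t).
rewrite gB ?te ?ltW // Bp gA; last by rewrite mulrC tk mulr_ge0 // ltW.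
rewrite gA ?tea ?ltW // gB'; last by rewrite mulrC ta mulr_ge0 // ltW.
have tak' : 0 <= k' * (a * t) <= e'.
  have -> : k' * (a * t) = t * (a * k') by ring.
  by rewrite tak !mulr_ge0 // ltW.
rewrite BAp gB' //.
rewrite BAp => /addrI E; apply: (mulfI (lt0r_neq0 a0)); apply: (mulIf (lt0r_neq0 t0)).
by rewrite -mulrA E; ring.
Qed.

(** Passing from a fixed point [p] to [A p] replaces a right slope [k] by its square root [k'],
    which is strictly closer to 1 because [k - 1 = (k' - 1) * (k' + 1)]. A finite list of slopes
    excludes such a descent. *)
Lemma baumslag_solitar_line A B SA SB :
  germs_in SA A -> germs_in SB B ->
  {homo A : x y / x < y} -> {homo B : x y / x < y} ->
  (forall t, A (B t) = B (B (A t))) -> (forall x, exists2 q, q <= x & B q = q) ->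
  forall x, B x = x.
Proof.
move=> AS BS A_lt B_lt AB fixB x; apply: contrapT => Bx.
have [p [k [Bp gB kS k1]]] := germ_at_boundary BS B_lt (fixB x) Bx.
pose P k := k \in SB /\ k != 1 /\ exists2 p, B p = p & right_germ B p k.
apply: (@no_finite_descent R R SB P (fun k => `|k - 1|) _ _ k).
- by move=> ? [].
- move=> {p k Bp gB kS k1} k [kS [k1 [p Bp gB]]].
  have [[a _ gA] _] := AS p; have [[k' k'S gB'] _] := BS (A p).
  have BAp : B (A p) = A p by apply: double_fix => //; rewrite -AB Bp.
  have kk' := germ_conj A_lt B_lt AB Bp gA gB BAp gB'.
  have k'0 := right_germ_gt0 B_lt gB'.
  have k'1 : k' != 1 by apply: contra_neq k1 => k'1; rewrite kk' k'1 expr1n.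
  exists k'; first by split=> //; split=> //; exists (A p).
  rewrite kk' subr_sqr_1 normrM ltr_pMr ?normr_gt0 ?subr_eq0 //.
  by rewrite ger0_norm; lra.
- by split=> //; split=> //; exists p.
Qed.

Lemma piecewise_linear_germs (a b : R) F : piecewise_linear a b F -> exists S,
  (forall p, a <= p < b -> exists2 k, k \in S & right_germ F p k) /\
  (forall p, a < p <= b -> exists2 l, l \in S & left_germ F p l).
Proof.
move=> [s]; elim: s a => [|x s IH] a as_ lin.
  by exists [::]; split=> p; rewrite -(itv_partition_nil as_) => /andP[]; lra.
have ax : a < x by case: as_ => /= /andP[].
have [|S [Sr Sl]] := IH x (itv_partition_cons as_); first by move=> i si; exact: (lin i.+1 si).
have [k [c Fk]] := lin 0%N isT; rewrite /= in Fk.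
exists (k :: S); split=> p /andP[p1 p2].
- case: (ltP p x) => px; last first.
    have [|k' k'S] := Sr p; first by rewrite px.
    by exists k' => //; rewrite in_cons k'S orbT.
  exists k; first by rewrite mem_head.
  exists (x - p); first by rewrite subr_gt0.
  by move=> t t1; rewrite !Fk ?in_itv /=; lra.
- case: (leP p x) => px; last first.
    have [|k' k'S] := Sl p; first by rewrite px.
    by exists k' => //; rewrite in_cons k'S orbT.
  exists k; first by rewrite mem_head.
  exists (p - a); first by rewrite subr_gt0.
  by move=> t t1; rewrite !Fk ?in_itv /=; lra.
Qed.

End Germs.

(** * Lifts of circle homeomorphisms *)

Section ContinuousReal.
Context {R : realType}.
Implicit Types (f F A B : R -> R).

Lemma IVT_between f s t v : continuous f -> f s <= v <= f t ->
  exists2 c, Num.min s t <= c <= Num.max s t & f c = v.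
Proof.
move=> cf /andP[sv vt].
have cab a b : {within `[a, b], continuous f} by exact: continuous_subspaceT.
case: (leP s t) => st.
  have [|c] := @IVT R f s t v st (cab _ _); last by rewrite in_itv; exists c.
  by rewrite ge_min sv le_max vt orbT.
have [|c] := @IVT R f t s v (ltW st) (cab _ _); last by rewrite in_itv; exists c.
by rewrite ge_min sv le_max vt orbT.
Qed.

Lemma int_lt_succ (x y : R) : x \is a Num.int -> y \is a Num.int -> x < y -> x + 1 <= y.
Proof.
move=> /intrP[m ->] /intrP[n ->]; rewrite ltr_int -[X in _ + X]/(1%:~R) -intrD ler_int.
by rewrite lezD1.
Qed.

Lemma half_notin_int (x : R) : x \is a Num.int -> x + 2^-1 \isn't a Num.int.
Proof.
move=> xi; apply/negP => yi.
by have := int_lt_succ xi yi; lra.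
Qed.

Lemma continuous_int_const f : continuous f -> (forall t, f t \is a Num.int) ->
  forall s t, f s = f t.
Proof.
move=> cf fi s t; wlog st : s t / f s < f t.
  by move=> W; case: (ltgtP (f s) (f t)) => // h; [exact: W|apply/esym/W].
have le1 := int_lt_succ (fi s) (fi t) st.
have [|c _ fc] := @IVT_between f s t (f s + 2^-1) cf; first by lra.
by have := half_notin_int (fi s); rewrite -fc fi.
Qed.

Lemma fixed_point_or f : continuous f ->
  (exists x, f x = x) \/ (forall x, x < f x) \/ (forall x, f x < x).
Proof.
move=> cf; have [|no] := pselect (exists x, f x = x); first by left.
right; have [|up] := pselect (forall x, x < f x); first by left.
right=> x; rewrite ltNge; apply/negP => fx; apply: no.
have [y fy] : exists y, f y <= y.
  by apply: contrapT => /forallNP all_gt; apply: up => y; rewrite ltNge; apply/negP/all_gt.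
have [||c _ fc] := @IVT_between (fun t => f t - t) y x 0.
- by move=> t; apply: cvgB; [exact: cf|exact: cvg_id].
- by lra.
- by exists c; lra.
Qed.

(* [B] has bounded displacement along the orbit of [A], although
   [A^m B = B^(2^m) A^m]. *)
Lemma baumslag_solitar_not_gt A B : continuous B ->
  {homo A : x y / x < y} -> {homo B : x y / x < y} ->
  (forall t (n : int), A (t + n%:~R) = A t + n%:~R) ->
  (forall t (n : int), B (t + n%:~R) = B t + n%:~R) ->
  (forall t, A (B t) = B (B (A t))) -> ~ (forall x, x < B x).
Proof.
move=> cB A_lt B_lt A1 B1 AB B_gt.
have [|c _ minc] := @EVT_min R (fun t => B t - t) 0 1 ler01.
  by apply: continuous_subspaceT => t; apply: cvgB; [exact: cB|exact: cvg_id].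
have d0 : 0 < B c - c by rewrite subr_gt0.
set d := B c - c in minc d0.
have B_ge t : t + d <= B t.
  have := minc (frac_part t); rewrite in_itv /= frac_part_ge0 ltW ?frac_part_lt1 // => /(_ isT).
  have := B1 (frac_part t) (Num.floor t).
  by rewrite addrC -floor_frac => ->; rewrite {3}(floor_frac t); lra.
have iterB n t : t + n%:R * d <= iter n B t.
  elim: n => [|n IH]; first by rewrite mul0r addr0.
  by rewrite iterS -natr1; have := B_ge (iter n B t); lra.
have AiterB n t : A (iter n B t) = iter (n + n) B (A t).
  elim: n t => // n IH t; rewrite iterS AB IH -!iterS.
  by congr (iter _ B); rewrite addnS addSn.
have iterAB m t : iter m A (B t) = iter (2 ^ m) B (iter m A t).
  elim: m t => // m IH t; rewrite iterS IH AiterB iterS.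
  by rewrite addnn -mul2n expnS.
pose N := (Num.floor (B 0) + 1)%R.
have BN : B 0 <= N%:~R by rewrite ltW // floorD1_gt.
have iterA_int m : iter m A N%:~R = iter m A 0 + N%:~R.
  elim: m => [|m IH]; first by rewrite add0r.
  by rewrite !iterS IH A1.
have iterA_le m s t : s <= t -> iter m A s <= iter m A t.
  elim: m s t => // m IH s t st; rewrite !iterS.
  by have := IH _ _ st; rewrite le_eqVlt => /predU1P[->//|/A_lt/ltW].
(* [A^m (B 0)] is at most [A^m 0 + N], as [B 0 <= N], and at least [A^m 0 + 2^m * d], as each
   application of [B] advances by at least [d]. *)
have bound m : (2 ^ m)%:R * d <= N%:~R.
  have := iterA_le m _ _ BN; rewrite iterA_int iterAB => h.
  by have := le_trans (iterB (2 ^ m)%N (iter m A 0)) h; lra.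
have [m mN] : exists m : nat, N%:~R / d < m%:R.
  by exists (Num.bound `|N%:~R / d|); apply: le_lt_trans (ler_norm _) (archi_boundP (normr_ge0 _)).
have := bound m; rewrite -ler_pdivlMr // leNgt => /negP; apply.
by apply: lt_trans mN _; rewrite ltr_nat ltn_expl.
Qed.

(** Without a fixed point, [B] moves all points to the same side; the leftward case is reduced to
    the other one by conjugating with [t |-> - t]. *)
Lemma baumslag_solitar_fixed_point A B : continuous B ->
  {homo A : x y / x < y} -> {homo B : x y / x < y} ->
  (forall t (n : int), A (t + n%:~R) = A t + n%:~R) ->
  (forall t (n : int), B (t + n%:~R) = B t + n%:~R) ->
  (forall t, A (B t) = B (B (A t))) -> exists x, B x = x.
Proof.
move=> cB A_lt B_lt A1 B1 AB.
have [//|[B_gt|B_gt]] := fixed_point_or cB.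
  by case: (baumslag_solitar_not_gt cB A_lt B_lt A1 B1 AB).
have mirror_homo f : {homo f : x y / x < y} -> {homo (fun t => - f (- t)) : x y / x < y}.
  by move=> f_lt x y xy; rewrite ltrN2; apply: f_lt; rewrite ltrN2.
have mirror_int f : (forall t (n : int), f (t + n%:~R) = f t + n%:~R) ->
    forall t (n : int), - f (- (t + n%:~R)) = - f (- t) + n%:~R.
  by move=> f1 t n; rewrite opprD -intrN f1 intrN opprD opprK.
case: (@baumslag_solitar_not_gt (fun t => - A (- t)) (fun t => - B (- t))).
- move=> t; apply: cvgN; apply: (@continuous_comp _ _ _ -%R B); last exact: cB.
  exact: opp_continuous.
- exact: mirror_homo.
- exact: mirror_homo.
- exact: mirror_int.
- exact: mirror_int.
- by move=> t; rewrite !opprK AB.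
- by move=> x; rewrite -ltrN2 opprK.
Qed.

End ContinuousReal.

Section CircleLifts.
Context {R : realType}.
Implicit Types (h : homeo (circle R)) (F : R -> R).

Definition circle_lift h F := continuous F /\ forall t, h (to_circle t) = to_circle (F t).

Lemma circle_liftM h h' F F' : circle_lift h F -> circle_lift h' F' ->
  circle_lift (h * h')%g (F \o F').
Proof.
move=> [cF hF] [cF' hF']; split; first by move=> t; apply: continuous_comp; [exact: cF'|exact: cF].
by move=> t; rewrite -hF -hF'.
Qed.

Lemma circle_lift_eq h F s t : circle_lift h F ->
  (F s - F t \is a Num.int) = (s - t \is a Num.int).
Proof.
move=> [_ hF]; apply/idP/idP => /to_circleP.
  by rewrite -!hF => /(can_inj (homeoK h)) /to_circleP.
by move=> st; apply/to_circleP; rewrite -!hF st.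
Qed.

(** [F (t + 1) - F t] is continuous and takes integer values, hence is a constant, the degree. *)
Lemma circle_lift_degree h F : circle_lift h F -> exists2 d, d \is a Num.int &
  forall t (n : int), F (t + n%:~R) = F t + n%:~R * d.
Proof.
move=> hF; have [cF _] := hF.
pose D t := F (t + 1) - F t.
have Di t : D t \is a Num.int.
  by rewrite /D (circle_lift_eq _ _ hF) addrAC subrr add0r rpred1.
have cD : continuous D.
  have cF1 : continuous (F \o (fun t => t + 1)).
    move=> t; apply: continuous_comp; last exact: cF.
    by apply: cvgD; [exact: cvg_id|exact: cvg_cst].
  by move=> t; apply: cvgB; [exact: cF1|exact: cF].
exists (D 0) => // t n.
have F1 s : F (s + 1) = F s + D 0 by rewrite (continuous_int_const cD Di 0 s) /D; ring.
have Fn (m : nat) s : F (s + m%:R) = F s + m%:R * D 0.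
  elim: m => [|m IH]; first by rewrite mul0r !addr0.
  by rewrite -natr1 addrA F1 IH; ring.
case: n => m; first by rewrite -pmulrn Fn.
rewrite NegzE intrN mulNr -pmulrn.
by apply: (@addIr _ (m.+1%:R * D 0)); rewrite -Fn !subrK.
Qed.

Lemma circle_lift_inj h F : circle_lift h F -> injective F.
Proof.
move=> hF; have [cF _] := hF; have [d _ Fd] := circle_lift_degree hF.
(* In degree 0 one has [F 0 = F 1], and the mean of [F 0] and [F (1/2)] is attained inside both
   halves of the unit interval. The two points do not differ by an integer, against the injectivity
   of [h]. *)
have d0 : d != 0.
  apply/eqP => d0.
  have F01 : F 1 = F 0 by have := Fd 0 1; rewrite add0r d0 mulr0 addr0.
  have half_not_int : (2^-1 : R) \isn't a Num.int.
    by have := half_notin_int (int_num0 R); rewrite add0r.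
  have F0h : F 0 != F 2^-1.
    apply/eqP => e; have := circle_lift_eq 2^-1 0 hF.
    by rewrite e subrr rpred0 subr0 (negbTE half_not_int).
  have cross s : F s != F 2^-1 -> exists2 c, Num.min s 2^-1 <= c <= Num.max s 2^-1 &
      F c = (F s + F 2^-1) / 2.
    by rewrite neq_lt => /orP[?|?]; [|rewrite minC maxC]; apply: IVT_between => //; lra.
  have [c1] := cross _ F0h.
  have [c2] := cross 1 (eq_ind_r (fun u => u != _) F0h F01).
  rewrite F01 (min_r (_ : 2^-1 <= 1)) ?(max_l (_ : 2^-1 <= 1)); try lra.
  rewrite (min_l (_ : 0 <= 2^-1)) ?(max_r (_ : 0 <= 2^-1)); try lra.
  move=> c2i Fc2 c1i Fc1.
  have ci : c2 - c1 \is a Num.int by rewrite -(circle_lift_eq _ _ hF) Fc1 Fc2 subrr rpred0.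
  have c10 : c1 != 0 by apply: contra_neq F0h => c10; move: Fc1; rewrite c10; lra.
  have c21 : c2 != 1 by apply: contra_neq F0h => c21; move: Fc2; rewrite c21 F01; lra.
  have c1h : c1 != 2^-1 by apply: contra_neq F0h => c1h; move: Fc1; rewrite c1h; lra.
  have c10' : 0 < c1 by rewrite lt_neqAle eq_sym c10; case/andP: c1i.
  have c21' : c2 < 1 by rewrite lt_neqAle c21; case/andP: c2i.
  have c1h' : c1 < 2^-1 by rewrite lt_neqAle c1h; case/andP: c1i.
  have /andP[c2h _] := c2i.
  have := int_lt_succ (int_num0 R) ci; lra.
move=> s t Fst; have : s - t \is a Num.int by rewrite -(circle_lift_eq _ _ hF) Fst subrr rpred0.
move=> /intrP[n stn]; have sE : s = t + n%:~R by rewrite -stn addrC subrK.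
move: Fst; rewrite sE Fd -[X in _ = X]addr0 => /addrI /eqP.
by rewrite mulf_eq0 (negbTE d0) orbF => /eqP ->; rewrite addr0.
Qed.

Lemma circle_lift_mono h F : circle_lift h F ->
  {homo F : x y / x < y} \/ {homo F : x y /~ x < y}.
Proof.
move=> hF; have F_inj := circle_lift_inj hF; have [cF _] := hF.
have [] := @itv_continuous_inj_mono R F `]-oo, +oo[.
- exact: continuous_subspaceT.
- by move=> x y _ _; exact: F_inj.
- by move=> F_lt; left=> x y; apply: F_lt; rewrite in_itv.
- by move=> F_lt; right=> x y; apply: F_lt; rewrite in_itv.
Qed.

(** In degree above 1, [F] would take the value [F 0 + 1] strictly between 0 and 1, against the
    injectivity of [h]. *)
Lemma circle_lift_incr_degree h F : circle_lift h F -> {homo F : x y / x < y} ->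
  forall t (n : int), F (t + n%:~R) = F t + n%:~R.
Proof.
move=> hF F_lt t n; have [d di Fd] := circle_lift_degree hF; have [cF _] := hF.
suff d1 : d = 1 by rewrite Fd d1 mulr1.
have F1 : F 1 = F 0 + d by have := Fd 0 1; rewrite add0r mul1r.
have d0 : 0 < d by have := F_lt _ _ (@ltr01 R); rewrite F1; lra.
have d1 : 1 <= d by have := int_lt_succ (int_num0 R) di d0; rewrite add0r.
apply/eqP; rewrite eq_le d1 andbT leNgt; apply/negP => d_gt1.
have [|c c01 Fc] := @IVT_between R F 0 1 (F 0 + 1) cF; first by rewrite F1; lra.
rewrite min_l // max_r // in c01.
have : c - 0 \is a Num.int by rewrite -(circle_lift_eq _ _ hF) Fc addrAC subrr add0r rpred1.
rewrite subr0 => ci; have c0 : c != 0.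
  by apply/eqP => c0; move: Fc; rewrite c0; lra.
have c1 : c != 1 by apply/eqP => c1; move: Fc; rewrite c1 F1; lra.
have c0' : 0 < c by rewrite lt_neqAle eq_sym c0; case/andP: c01.
have c1' : c < 1 by rewrite lt_neqAle c1; case/andP: c01.
by have := int_lt_succ (int_num0 R) ci c0'; lra.
Qed.

Lemma PL_circle_germs h F : circle_lift h F -> piecewise_linear 0 1 F ->
  exists S, germs_in S F.
Proof.
move=> hF /piecewise_linear_germs[S [Sr Sl]]; exists S => p.
have [d di Fd] := circle_lift_degree hF.
have f0 := frac_part_ge0 p; have f1 := frac_part_lt1 p.
split.
  have [|k kS [e e0 Fe]] := Sr (frac_part p); first by rewrite f0.
  exists k => //; exists e => // t /Fe E.
  rewrite {1 2}(floor_frac p) -addrA [_ + (_ + t)]addrC Fd E.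
  by rewrite [_ + frac_part p]addrC Fd; ring.
have left_shift q (n : int) l : left_germ F q l -> left_germ F (q + n%:~R) l.
  move=> [e e0 Fe]; exists e => // t /Fe E.
  by rewrite addrAC Fd E Fd; ring.
(* At an integer, the left germ is that at the end point 1 of the fundamental domain, shifted. *)
have [fp0|fp0] := eqVneq (frac_part p) 0.
  have [|l lS Fl] := Sl 1; first by rewrite ltr01 lexx.
  exists l => //; have -> : p = 1 + (Num.floor p - 1)%:~R.
    by rewrite intrB addrC subrK {1}(floor_frac p) fp0 addr0.
  exact: left_shift.
have [|l lS Fl] := Sl (frac_part p); first by rewrite lt_neqAle eq_sym fp0 f0 ltW.
by exists l => //; rewrite {1}(floor_frac p) addrC; exact: left_shift.
Qed.

Lemma circle_BS_trivial (alpha beta : homeo (circle R)) :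
  PL_circle alpha -> PL_circle beta ->
  (alpha * alpha * beta = beta * beta * (alpha * alpha))%g -> beta = 1%g.
Proof.
move=> [Fa [cFa aF PLa]] [Fb [cFb bF PLb]] rel.
have liftFa : circle_lift alpha Fa by [].
have liftFb : circle_lift beta Fb by [].
pose A := Fa \o Fa.
have liftA : circle_lift (alpha * alpha)%g A := circle_liftM liftFa liftFa.
(* The square of a monotone lift is increasing, whatever the orientation. *)
have A_lt : {homo A : x y / x < y}.
  by case: (circle_lift_mono liftFa) => F_lt x y xy; exact: (F_lt _ _ (F_lt _ _ xy)).
have A1 := circle_lift_incr_degree liftA A_lt.
have [Sa Fa_germs] := PL_circle_germs liftFa PLa.
have A_germs := germs_comp Fa_germs Fa_germs.
(* Both sides of the relation lift the same circle map, so they differ by a constant integer [j]. *)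
pose J t := A (Fb t) - Fb (Fb (A t)).
have liftL := circle_liftM liftA liftFb.
have liftR := circle_liftM (circle_liftM liftFb liftFb) liftA.
have Ji t : J t \is a Num.int.
  by apply/to_circleP; have := liftL.2 t; rewrite rel liftR.2 => ->.
have cJ : continuous J by move=> t; apply: cvgB; [exact: liftL.1|exact: liftR.1].
have [j jE] : exists j : int, J 0 = j%:~R by apply/intrP.
have AFb t : A (Fb t) = Fb (Fb (A t)) + j%:~R.
  by rewrite -jE (continuous_int_const cJ Ji 0 t) /J addrC subrK.
(* If [Fb] were decreasing, one side of the relation would be decreasing and the other
   increasing. *)
have Fb_lt : {homo Fb : x y / x < y}.
  case: (circle_lift_mono liftFb) => // F_gt.
  have := F_gt _ _ (F_gt _ _ (A_lt _ _ (@ltr01 R))).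
  by have := A_lt _ _ (F_gt _ _ (@ltr01 R)); rewrite !AFb; lra.
have Fb1 := circle_lift_incr_degree liftFb Fb_lt.
have [Sb Fb_germs] := PL_circle_germs liftFb PLb.
(* This other lift absorbs the constant: the left side of the relation grows by [j] and the right
   side by [2 * j]. *)
pose B t := Fb t + j%:~R.
have B_lt : {homo B : x y / x < y} by move=> x y /Fb_lt; rewrite ltrD2r.
have cB : continuous B by move=> t; apply: cvgD; [exact: cFb|exact: cvg_cst].
have B1 t (n : int) : B (t + n%:~R) = B t + n%:~R by rewrite /B Fb1 addrAC.
have AB t : A (B t) = B (B (A t)) by rewrite /B A1 AFb Fb1.
have B_germs : germs_in Sb B.
  move=> p; have [[k kS [e e0 Fe]] [l lS [e' e'0 Fe']]] := Fb_germs p; split.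
    by exists k => //; exists e => // t /Fe; rewrite /B => ->; ring.
  by exists l => //; exists e' => // t /Fe'; rewrite /B => ->; ring.
have [x0 Bx0] := baumslag_solitar_fixed_point cB A_lt B_lt A1 B1 AB.
have B_id : forall x, B x = x.
  apply: (baumslag_solitar_line A_germs B_germs A_lt B_lt AB) => x.
  exists (x0 + (Num.floor (x - x0))%:~R); last by rewrite B1 Bx0.
  by have := floor_le (x - x0); lra.
apply: homeoP => x; rewrite -[x]reprK -/(to_circle _) bF; apply/to_circleP.
have := B_id (repr x); rewrite /B => Bx.
have -> : Fb (repr x) - repr x = (- j)%:~R by rewrite intrN; lra.
exact: intr_int.
Qed.

End CircleLifts.

(** * Piecewise linear actions on the interval *)

Section IntervalLifts.
Context {R : realType}.
Implicit Types (h : homeo (unit_interval R)) (F : R -> R).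

(** It will be used with the identity and with [t |-> 1 - t] outside [[0, 1]], so that
    [baumslag_solitar_line] applies to maps of the interval. *)
Definition affine_extension (sigma c : R) F (t : R) : R :=
  if 0 <= t <= 1 then F t else sigma * t + c.

Lemma affine_extension_in sigma c F t : 0 <= t <= 1 -> affine_extension sigma c F t = F t.
Proof. by rewrite /affine_extension => ->. Qed.

Lemma affine_extension_out sigma c F t : F 0 = c -> F 1 = sigma + c ->
  ~~ (0 < t < 1) -> affine_extension sigma c F t = sigma * t + c.
Proof.
move=> F0 F1; rewrite negb_and -!leNgt /affine_extension => t_out.
case: ifP => // t01; have [->|->] : t = 0 \/ t = 1.
- by case/orP: t_out; [left|right]; lra.
- by rewrite F0 mulr0 add0r.
- by rewrite F1 mulr1.
Qed.

Lemma affine_extension_germs sigma c F : F 0 = c -> F 1 = sigma + c ->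
  piecewise_linear 0 1 F -> exists S, germs_in S (affine_extension sigma c F).
Proof.
move=> F0 F1 /piecewise_linear_germs[S [Sr Sl]]; exists (sigma :: S).
have out t : ~~ (0 < t < 1) -> affine_extension sigma c F t = sigma * t + c.
  exact: affine_extension_out.
have le0 t : t <= 0 -> affine_extension sigma c F t = sigma * t + c.
  by move=> t0; apply: out; rewrite negb_and -!leNgt t0.
have ge1 t : 1 <= t -> affine_extension sigma c F t = sigma * t + c.
  by move=> t1; apply: out; rewrite negb_and -!leNgt t1 orbT.
move=> p; split.
- case: (ltP p 0) => p0.
    exists sigma; first by rewrite mem_head.
    exists (- p); first lra.
    by move=> t t0; rewrite !le0; [ring|lra|lra].
  case: (ltP p 1) => p1; last first.
    exists sigma; first by rewrite mem_head.
    exists 1 => // t t0; rewrite !ge1; [ring|lra|lra].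
  have [|k kS [e e0 Fe]] := Sr p; first by rewrite p0.
  exists k; first by rewrite in_cons kS orbT.
  exists (Num.min e (1 - p)); first by rewrite lt_min e0 subr_gt0.
  move=> t /andP[t0]; rewrite le_min => /andP[te tp].
  by rewrite !affine_extension_in ?Fe ?t0 //; lra.
- case: (leP p 0) => p0.
    exists sigma; first by rewrite mem_head.
    exists 1 => // t t0; rewrite !le0; [ring|lra|lra].
  case: (leP p 1) => p1; last first.
    exists sigma; first by rewrite mem_head.
    exists (p - 1); first lra.
    by move=> t t0; rewrite !ge1; [ring|lra|lra].
  have [|k kS [e e0 Fe]] := Sl p; first by rewrite p0.
  exists k; first by rewrite in_cons kS orbT.
  exists (Num.min e p); first by rewrite lt_min e0.
  move=> t /andP[t0]; rewrite le_min => /andP[te tp].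
  by rewrite !affine_extension_in ?Fe ?t0 //; lra.
Qed.

(** [F] is continuous and injective on [[0, 1]], hence strictly monotone; surjectivity then
    determines its values at 0 and 1, where the affine extension fits. *)
Lemma PL_interval_lift h : PL_unit_interval h -> exists E S,
  [/\ germs_in S E, forall x, E (set_val x) = set_val (h x) &
    ({homo E : x y / x < y} /\ forall t, ~~ (0 <= t <= 1) -> E t = t) \/
    ({homo E : x y /~ x < y} /\ forall t, ~~ (0 <= t <= 1) -> E t = 1 - t)].
Proof.
move=> [F hF PLF].
have pt (t : R) : 0 <= t <= 1 -> exists x : unit_interval R, set_val x = t.
  move=> t01; have tin : t \in `[0, 1]%classic by apply/mem_set; rewrite /= in_itv.
  by exists (SigSub tin).
have F_in (t : R) : 0 <= t <= 1 -> 0 <= F t <= 1.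
  by move=> /pt[x <-]; rewrite -hF; exact: unit_interval_in.
have F_inj : {in `[0, 1] &, injective F}.
  move=> s t; rewrite !in_itv /= => /pt[x <-] /pt[y <-].
  by rewrite -!hF => /set_val_inj /(can_inj (homeoK h)) ->.
have F_surj (t : R) : 0 <= t <= 1 -> exists2 s, 0 <= s <= 1 & F s = t.
  move=> /pt[x <-]; exists (set_val (homeo_inv_fun h x)); first exact: unit_interval_in.
  by rewrite -hF homeoVK.
have cF : {within `[0, 1], continuous F}.
  apply/subspace_sigL_continuousP; rewrite (_ : sigL _ F = set_val \o h).
    move=> x; apply: continuous_comp; first exact: homeo_continuous.
    exact: initial_continuous.
  by apply/funext => x /=; rewrite hF.
have i0 : 0 <= (0 : R) <= 1 by rewrite lexx ler01.
have i1 : 0 <= (1 : R) <= 1 by rewrite lexx ler01.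
have /andP[F00 F01] := F_in _ i0; have /andP[F10 F11] := F_in _ i1.
have [s0 s0i Fs0] := F_surj 0 i0; have [s1 s1i Fs1] := F_surj 1 i1.
have in01 (t : R) : (t \in `[0, 1]) = (0 <= t <= 1) by rewrite in_itv.
have notin (t : R) : ~~ (0 <= t <= 1) -> t < 0 \/ 1 < t.
  by rewrite negb_and -!ltNge => /orP.
have [F_lt|F_gt] := itv_continuous_inj_mono cF F_inj.
- have lt01 s t : 0 <= s <= 1 -> 0 <= t <= 1 -> s < t -> F s < F t.
    by move=> si ti; apply: F_lt; rewrite in01.
  have F0 : F 0 = 0.
    have [s00|s0_neq] := eqVneq s0 0; first by move: Fs0; rewrite s00.
    have s0_gt : 0 < s0 by rewrite lt_neqAle eq_sym s0_neq; case/andP: s0i.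
    by have := lt01 _ _ i0 s0i s0_gt; lra.
  have F1 : F 1 = 1 + 0.
    have [s11|s1_neq] := eqVneq s1 1; first by move: Fs1; rewrite s11 addr0.
    have s1_lt : s1 < 1 by rewrite lt_neqAle s1_neq; case/andP: s1i.
    by have := lt01 _ _ s1i i1 s1_lt; lra.
  have [S ES] := affine_extension_germs F0 F1 PLF.
  exists (affine_extension 1 0 F), S.
  have E_out t : ~~ (0 <= t <= 1) -> affine_extension 1 0 F t = t.
    by move=> /negbTE t_out; rewrite /affine_extension t_out mul1r addr0.
  split => //; first by move=> x; rewrite affine_extension_in ?hF //; exact: unit_interval_in.
  left; split => // x y xy.
  have [xi|xo] := boolP (0 <= x <= 1); have [yi|yo] := boolP (0 <= y <= 1).
  + by rewrite !affine_extension_in //; exact: lt01.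
  + rewrite (E_out _ yo) affine_extension_in //.
    by have := F_in _ xi; have := notin _ yo; lra.
  + rewrite (E_out _ xo) affine_extension_in //.
    by have := F_in _ yi; have := notin _ xo; lra.
  + by rewrite !E_out.
- have gt01 s t : 0 <= s <= 1 -> 0 <= t <= 1 -> s < t -> F t < F s.
    by move=> si ti; apply: F_gt; rewrite in01.
  have F0 : F 0 = 1.
    have [s10|s1_neq] := eqVneq s1 0; first by move: Fs1; rewrite s10.
    have s1_gt : 0 < s1 by rewrite lt_neqAle eq_sym s1_neq; case/andP: s1i.
    by have := gt01 _ _ i0 s1i s1_gt; lra.
  have F1 : F 1 = -1 + 1.
    have [s01|s0_neq] := eqVneq s0 1; first by move: Fs0; rewrite s01 addNr.
    have s0_lt : s0 < 1 by rewrite lt_neqAle s0_neq; case/andP: s0i.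
    by have := gt01 _ _ s0i i1 s0_lt; lra.
  have [S ES] := affine_extension_germs F0 F1 PLF.
  exists (affine_extension (-1) 1 F), S.
  have E_out t : ~~ (0 <= t <= 1) -> affine_extension (-1) 1 F t = 1 - t.
    by move=> /negbTE t_out; rewrite /affine_extension t_out mulN1r addrC.
  split => //; first by move=> x; rewrite affine_extension_in ?hF //; exact: unit_interval_in.
  right; split => // y x xy.
  have [xi|xo] := boolP (0 <= x <= 1); have [yi|yo] := boolP (0 <= y <= 1).
  + by rewrite !affine_extension_in //; exact: gt01.
  + rewrite (E_out _ yo) affine_extension_in //.
    by have := F_in _ xi; have := notin _ yo; lra.
  + rewrite (E_out _ xo) affine_extension_in //.
    by have := F_in _ yi; have := notin _ xo; lra.
  + by rewrite !E_out //; lra.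
Qed.

Lemma interval_BS_trivial (alpha beta : homeo (unit_interval R)) :
  PL_unit_interval alpha -> PL_unit_interval beta ->
  (alpha * alpha * beta = beta * beta * (alpha * alpha))%g -> beta = 1%g.
Proof.
move=> /PL_interval_lift[Ea [Sa [Ea_germs EaE Ea_mono]]].
move=> /PL_interval_lift[B [Sb [B_germs BE B_mono]]] rel.
pose A := Ea \o Ea.
have A_germs := germs_comp Ea_germs Ea_germs.
have A_lt : {homo A : x y / x < y}.
  by case: Ea_mono => -[F_lt _] x y xy; exact: (F_lt _ _ (F_lt _ _ xy)).
have A_out t : ~~ (0 <= t <= 1) -> A t = t.
  rewrite /A /=; case: Ea_mono => -[_ E_out] t_out; first by rewrite !E_out.
  rewrite [Ea t]E_out // E_out; first by lra.
  by apply: contra t_out; lra.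
have AE x : A (set_val x) = set_val ((alpha * alpha)%g x) by rewrite /A /= !EaE.
have AB_in t : 0 <= t <= 1 -> A (B t) = B (B (A t)).
  move=> t01; have tin : t \in `[0, 1]%classic by apply/mem_set; rewrite /= in_itv.
  rewrite -[t]/(set_val (SigSub tin : unit_interval R)); move: (SigSub tin) => x.
  rewrite BE !AE !BE; congr set_val.
  exact: (congr1 (fun h : homeo (unit_interval R) => h x) rel).
(* As on the circle, a decreasing [B] would give the two sides of the relation opposite
   monotonicity. *)
have [B_lt B_out] : {homo B : x y / x < y} /\ forall t, ~~ (0 <= t <= 1) -> B t = t.
  case: B_mono => // -[B_gt _].
  have := B_gt _ _ (B_gt _ _ (A_lt _ _ (@ltr01 R))).
  have := A_lt _ _ (B_gt _ _ (@ltr01 R)).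
  by rewrite !AB_in ?lexx ?ler01 //; lra.
have AB t : A (B t) = B (B (A t)).
  have [/AB_in//|t_out] := boolP (0 <= t <= 1).
  by rewrite B_out // A_out // !B_out.
have B_id : forall x, B x = x.
  apply: (baumslag_solitar_line A_germs B_germs A_lt B_lt AB) => x.
  exists (Num.min x (-1)); first by rewrite ge_min lexx.
  by rewrite B_out // negb_and -ltNge gt_min; apply/orP; left; apply/orP; right; lra.
by apply: homeoP => x; apply: set_val_inj; rewrite -BE B_id.
Qed.

End IntervalLifts.

(** * The obstruction to piecewise linear actions and the conclusion *)

Lemma no_faithful_PL_action (R : realType) (G : groupType) (S : set G) (a b : G) :
  generated S a -> generated S b -> (a * a * b = b * b * (a * a))%g -> b <> 1%g ->
  ~ has_faithful_PL_action R (generated S).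
Proof.
move=> Sa Sb rel b1 act.
have transfer (H : groupType) (P : set H) :
    (forall u v, P u -> P v -> (u * u * v = v * v * (u * u))%g -> v = 1%g) ->
    ~ faithful_action_by (generated S) P.
  move=> P_trivial [rho [rhoM rho_inj rhoP]].
  have inS x : generated S x -> x \in generated S by move/mem_set.
  have rM x y : generated S x -> generated S y -> rho (x * y)%g = (rho x * rho y)%g.
    by move=> Sx Sy; apply: rhoM; exact: inS.
  have S1 : generated S 1%g by exact: generated1.
  have rho1 : rho 1%g = 1%g by apply: (mulgI (rho 1%g)); rewrite -rM // !mulg1.
  apply: b1; apply: rho_inj; [exact: inS|exact: inS|rewrite rho1].
  apply: (P_trivial (rho a)); [by apply: rhoP; exists a|by apply: rhoP; exists b|].
  by rewrite -!rM ?rel //; exact: generatedM.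
case: act; apply: transfer.
- exact: interval_BS_trivial.
- exact: circle_BS_trivial.
Qed.

Theorem corollary1p8 (R : realType) :
  exists G : set (homeo (unit_interval R)),
    square_root_of_thompsonF G /\ ~ has_faithful_PL_action R G.
Proof.
have half_gt0 : 0 < 2^-1 :> R by rewrite invr_gt0.
(* There is no circularity: [beta] is built from [phi0] and [gR] alone, and the square of [fR] is
   [phi0] for every admissible [w]. *)
have [w w_beta w_fix] := conj_to_square half_gt0 (@beta_lt R) (@beta_fix R).
pose f := fR w_fix; pose g : ibij R := gR.
exists (generated [set unit_homeo f; unit_homeo g]).
have fg_gen (p q : ibij R) : [set unit_homeo p; unit_homeo q] = unit_homeo @` [set p; q].
  by rewrite image_setU !image_set1.
split.
  exists (unit_homeo f), (unit_homeo g); split.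
  - exact: unit_homeo_plus.
  - exact: unit_homeo_plus.
  - reflexivity.
  - rewrite -!(morph_exp unit_homeoM) fg_gen -(image_generated unit_homeoM).
    apply: (isomorphic_image unit_homeoM (@unit_homeo_inj R)).
    exact: thompson_fR_gR.
  - apply: (@two_chain_unit_homeo R f g 4 0); first by rewrite ltr0n.
      rewrite eqEsubset; split=> t; rewrite /= in_itv /=.
        by apply: contra_neqT; rewrite -leNgt; exact: fR_fix.
      by move=> /(fR_lt w_fix) ft; rewrite lt_eqF.
    rewrite eqEsubset; split=> t; rewrite /= in_itv /= andbT.
      by apply: contra_neqT; rewrite -leNgt; exact: gR_fix.
    by move=> /gR_lt gt; rewrite lt_eqF.
pose z := root_conjugator w_fix; pose b : ibij R := small_bump.
have b_z := bump_root_conjugator w_fix w_beta.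
have Gf : generated [set f; g] f by apply: sub_generated; left.
have Gg : generated [set f; g] g by apply: sub_generated; right.
have Gphi : generated [set f; g] phi0 by rewrite -(fR_sq w_fix); exact: generatedX.
have Gkappa : generated [set f; g] kappa.
  by do ![apply: generatedM|apply: generatedV|apply: generatedX].
have Gb : generated [set f; g] b.
  by do ![apply: generatedM|apply: generatedV|apply: generatedX].
have Gz : generated [set f; g] z.
  by do ![apply: generatedM|apply: generatedV|apply: generatedX].
(* The obstruction is applied to [z^-1], because [b z^2 = z^2 b^2] means [z^-2 b = b^2 z^-2]. *)
rewrite fg_gen; apply: (@no_faithful_PL_action _ _ _ (unit_homeo z^-1%g) (unit_homeo b)).
- by apply: morph_generated; [exact: unit_homeoM|exact: generatedV].
- by apply: morph_generated; first exact: unit_homeoM.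
- rewrite -!unit_homeoM; congr unit_homeo.
  have invert (H : groupType) (u v : H) :
      (v * u = u * (v * v) -> u^-1 * v = v * v * u^-1)%g.
    by move=> uv; apply: (mulgI u); apply: (mulIg u); rewrite mulVKg -[RHS]mulgA mulgVK.
  by rewrite -invgM; apply: invert; exact: b_z.
(* The point [1 + 1/4] is the middle of the support []1, 3/2[] of [b]. *)
- rewrite -(morph_one unit_homeoM) => /unit_homeo_inj /(congr1 (fun p : ibij R => p (1 + 4^-1))).
  rewrite ibij1 small_bumpE ifT; last by lra.
  rewrite [1 + 4^-1 - 1]addrAC subrr add0r => /addrI.
  by have := @beta_lt R 4^-1; lra.
Qed.
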